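(* Let $F$ be any finite set of positions of (three-heap, unlabeled) Nim. For a positive integer $N$ let $\pi(N)$ denote the number of $P$-positions $\{x,y,z\}$ (counted as multisets, i.e. with unlabeled heaps) of the game $\mathrm{Nim}-F$ with $x$, $y$ and $z$ all less than $N$. Then for every positive integer $n$, the limit $$\lim_{k\to\infty}\frac{\pi(n2^k)}{(n2^k)^2}$$ exists and is a nonzero real constant.
   Context: Nim here means three-heap Nim with unlabeled heaps: the positions are the three-element multisets $\{x,y,z\}$ of non-negative integers. The children of $\{x,y,z\}$ (the positions reachable in one move) are all multisets obtained by replacing exactly one of the three entries by a strictly smaller non-negative integer. For a finite set $F$ of positions, $\mathrm{Nim}-F$ is the game whose positions are the Nim positions not in $F$, with the same moves except that moves to positions in $F$ are not allowed (i.e. the game graph is the induced subgraph obtained by deleting the vertices in $F$). A player who cannot move loses. The positions of $\mathrm{Nim}-F$ are partitioned into $P$-positions and $N$-positions; this is the unique partition such that no $P$-position has a child (in $\mathrm{Nim}-F$) that is a $P$-position, and every $N$-position has at least one child (in $\mathrm{Nim}-F$) that is a $P$-position. *)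

(* Defs.v *)
From mathcomp Require Import all_boot all_order all_algebra.
From mathcomp Require Import finmap multiset.
From mathcomp Require Import all_classical all_reals all_analysis.
Set Implicit Arguments.
Unset Strict Implicit.
Unset Printing Implicit Defensive.
Local Open Scope mset_scope.
Local Open Scope classical_set_scope.
Local Open Scope nat_scope.

Definition position := {A : {mset nat} | size A == 3}.

Definition child (A B : position) : Prop :=
  exists x y, [/\ x \in val A, y < x & val B = (y +` (val A `\ x))%mset].

(* Since [P] and [N] contain only positions outside [F], the children that
   matter below are children in the induced subgraph Nim - F. *)
Definition PN_partition (F : {fset position}) (P N : set position) : Prop :=
  [/\ P `|` N = ~` [set` F],
      P `&` N = set0,
      forall A B, P A -> child A B -> ~ P B &
      forall A, N A -> exists2 B, child A B & P B].

Definition heap_sum (A : position) : nat := \sum_(x <- val A) x.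

Lemma child_heap_sum A B : child A B -> heap_sum B < heap_sum A.
Proof.
case=> x [y [xA yx EB]]; rewrite /heap_sum EB.
rewrite -{2}(msetB1K xA).
have sumD a (M : {mset nat}) :
    \sum_(i <- (a +` M)%mset) i = a + \sum_(i <- M) i.
  rewrite -(big_cons 0 addn a M xpredT id); apply: perm_big.
  by apply/allP => z _ /=; rewrite !count_mem_mset mset1DE (eq_sym a).
by rewrite !sumD ltn_add2r.
Qed.

(* At stage [k], positions with heap sum below [k] are correctly classified. *)
Fixpoint losing (F : {fset position}) (k : nat) (A : position) : Prop :=
  if k is k'.+1 then A \notin F /\ forall B, child A B -> ~ losing F k' B
  else False.

Lemma losing_stable F k l A :
  heap_sum A < k -> heap_sum A < l -> losing F k A <-> losing F l A.
Proof.
elim: k l A => [//|k IH] [//|l] A Ak Al /=.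
split=> -[AF H]; split=> // B AB.
  have tBA := child_heap_sum AB.
  by rewrite -IH ?(leq_trans tBA)//; exact: H.
have tBA := child_heap_sum AB.
by rewrite (IH l) ?(leq_trans tBA)//; exact: H.
Qed.

Lemma PN_partition_exists (F : {fset position}) : exists PN, PN_partition F PN.1 PN.2.
Proof.
pose P := [set A | losing F (heap_sum A).+1 A].
exists (P, ~` [set` F] `\` P); split => /=.
- apply/seteqP; split=> A /=; first by case=> [[/negP]|[]].
  by move=> AF; have [?|?] := pselect (P A); [left|right].
- by apply/seteqP; split=> A //= [? []].
- move=> A B [_ H] AB PB; apply: (H B AB).
  exact/(losing_stable F (ltnSn _) (child_heap_sum AB)).
- move=> A [AF NP]; apply: contrapT => H; apply: NP; split; first exact/negP.
  move=> B AB LB; apply: H; exists B => //.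
  exact/(losing_stable F (ltnSn _) (child_heap_sum AB)).
Qed.

Lemma PN_partition_unique F P N P' N' :
  PN_partition F P N -> PN_partition F P' N' -> P = P' /\ N = N'.
Proof.
move=> h h'.
have NE Q M : PN_partition F Q M -> M = ~` [set` F] `\` Q.
  case=> QM QIM _ _; apply/seteqP; split=> A; last first.
    by case; rewrite -QM => -[].
  move=> MA; split; first by rewrite -QM; right.
  by move=> QA; suff : (Q `&` M) A by rewrite QIM.
suff E : P = P' by split=> //; rewrite (NE _ _ h) (NE _ _ h') E.
have sub Q M Q' M' k : PN_partition F Q M -> PN_partition F Q' M' ->
    (forall B, heap_sum B < k -> Q B <-> Q' B) ->
    forall A, heap_sum A <= k -> Q A -> Q' A.
  move=> [QM _ QQ _] [QM' _ _ MQ] IH A Ak QA.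
  have : (Q' `|` M') A by rewrite QM' -QM; left.
  case=> // /MQ [B AB Q'B]; have := QQ _ _ QA AB.
  by case; apply/IH => //; exact: leq_trans (child_heap_sum AB) Ak.
have IH k : forall B, heap_sum B < k -> P B <-> P' B.
  elim: k => [//|k IH] B; rewrite ltnS => Bk.
  split; first exact: sub h h' IH B Bk.
  by apply: sub h' h _ B Bk => C Ck; split=> /IH; exact.
by apply/seteqP; split=> A /(IH _ _ (ltnSn _)).
Qed.

Definition P_positions (F : {fset position}) : set position :=
  (projT1 (cid (PN_partition_exists F))).1.

Definition N_positions (F : {fset position}) : set position :=
  (projT1 (cid (PN_partition_exists F))).2.

Lemma P_positionsP F : PN_partition F (P_positions F) (N_positions F).
Proof. exact: (projT2 (cid (PN_partition_exists F))). Qed.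

Definition box (N : nat) : set position :=
  [set A | forall x, x \in val A -> x < N].

Lemma finite_box N : finite_set (box N).
Proof.
pose f (t : 3.-tuple 'I_N) : {mset nat} := seq_mset [seq val i | i <- t].
have fin : finite_set (range f) by exact: finite_image.
have inj : {in (val : position -> _) @^-1` range f &, injective
    (val : position -> _)} by move=> ? ? _ _; exact: val_inj.
apply: sub_finite_set (finite_preimage inj fin) => A AN /=.
have sA : size (pmap (insub : _ -> option 'I_N) (val A)) == 3.
  rewrite size_pmap_sub (_ : count _ _ = size (val A)); first exact: (valP A).
  by apply/eqP; rewrite -all_count; apply/allP => x /AN.
exists (Tuple sA) => //; rewrite /f /= -[RHS]seq_mset_id; congr seq_mset.
rewrite (pmap_filter (insubK _)); apply/all_filterP/allP => x xA.
by rewrite isSome_insub; exact: AN.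
Qed.

(* [fset_set] is meaningful here by [finite_box]. *)
Definition nb_P_positions (F : {fset position}) (N : nat) : nat :=
  #|` fset_set (P_positions F `&` box N)|%fset.

(* Main.v *)
Require Import Defs.
From mathcomp Require Import all_boot all_order all_algebra.
From mathcomp Require Import finmap multiset.
From mathcomp Require Import all_classical all_reals all_analysis.
From mathcomp Require Import zify lra.
Set Implicit Arguments.
Unset Strict Implicit.
Unset Printing Implicit Defensive.
Import Order.TTheory GRing.Theory Num.Theory.
Import numFieldNormedType.Exports.
Local Open Scope classical_set_scope.
Local Open Scope ring_scope.

(** Let [f x y] be the heap [z] for which [{x, y, z}] is a P-position; it exists
    and is unique.  The table [f] is symmetric, each row is an involution, and
    away from [F] it obeys the excluded-value rule of Nim.  P-positions with a
    repeated heap are negligible, so it is enough to understand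
    [m T = tops f T T], the number of P-positions with distinct heaps whose
    largest heap is [T], and to show that its sum over [T < n 2^k] is
    asymptotic to a positive multiple of [4^k].

    Let [w T = mids f T] be the number of those whose middle heap is [T].
    Sorting the entries of column [T] gives [T = 2 m T + w T + 1] (tops_mids).
    Read the rows in order and record, for each later column [s], how many
    P-positions with top [s] have their middle heap among the rows read so far.
    Row [T] adds one to [w T] of the columns beyond [T].  Were these always the
    first [w T] columns, the whole evolution would be forced.  In general row
    [T] skips some columns; the excluded-value rule shows that, when [s] is
    skipped, at most [tops f T s] columns beyond [s] are used by that row
    (served_hole).  Hence any linear functional of the record evolves as in the
    forced evolution, up to one bracket per skipped column (charge_step).  Two
    functionals are used.

    - One is built from the convex potential [1/k].  Every bracket then has a
      favourable sign and a size at least of order [tops f T s / T^3], while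
      the forced part does not increase as long as [m T > 0], because
      [1/(2m) + 1/(2m+1) <= 1/m].  Being bounded below, this energy forces
      [delays f T / T^3] to be summable, where [delays f T] adds the
      [tops f T s] of the skipped columns (delays_summable).

    - The other is built from the ramp [max (X - s) 0], which is Lipschitz, so
      each bracket is at most [5 tops f T s].  Its forced part compares the
      sums of [m T (X - T)] over [T < X] for [X = 2Y] and [X = Y]: the
      first is [8] times the second up to [O(Y^2)] and the delays
      (weighted_doubling).

    Together these make the doubly integrated count at [n 2^k], divided by
    [8^k], a sequence of bounded variation (weighted_cvg); since the count
    itself is monotone, it is recovered by differencing (total_cvg).

    The energy argument requires [m T > 0] for all large [T].  If instead
    [m h = 0] for infinitely many [h], the corresponding squares [[0, h)^2] are
    closed under [f], and beside such a square [f] is a translate of Nim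
    addition.  The energy bounds the gap between consecutive closed squares by a
    factor [3]; this forces [h] to be a power of two and [f] to be Nim addition
    outside the square (closed_eventually_nim).  There [m (2T) = 2 m T] and
    [m (2T+1) = 2 m T + 1], so doubling is exact up to [O(Y)].

    Positivity of the limit comes from summing [s = 2 m s + w s + 1] over
    [s < Y]: the P-positions counted on the right lie in the box of side [2Y]
    (distinct_total_lower). *)

(** * Tables of third heaps *)

Local Open Scope nat_scope.

(** What the rest of the argument needs of a table of third heaps.  The
    involution laws hold everywhere; the excluded-value rule and the bounds are
    required only where an entry is at least [N], which hides the finite set of
    forbidden positions. *)
Record settled (N : nat) (f : nat -> nat -> nat) : Prop := Settled {
  tableC : forall x y, f x y = f y x;
  tableK : forall x y, f x (f x y) = y;
  table_mex : forall x y z, [|| N <= x, N <= y | N <= z] ->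
    z < f x y -> f x z < y \/ f z y < x;
  table_row0 : forall s, N <= s -> f 0 s = s;
  table_diag : forall s x, N <= s -> f x x <> s;
  table_le : forall s x y, N <= s -> f x y = s -> s <= x + y }.

(** For [T <= s], the number of P-positions with top heap [s], distinct heaps
    and middle heap below [T]. *)
Definition tops (f : nat -> nat -> nat) T s := \sum_(0 <= t < T) (f t s < t).
(** The number of P-positions with distinct heaps and middle heap [T]; the top
    heap is then below [2T] by [table_le]. *)
Definition mids (f : nat -> nat -> nat) T := \sum_(T.+1 <= s < T.*2) (f T s < T).

Lemma sum_pred1 a b c : \sum_(a <= u < b) (c == u) = (a <= c < b).
Proof.
elim: b => [|b IH]; first by rewrite big_geq // andbC.
case: (leqP a b) => ab; last by rewrite big_geq //; lia.
by rewrite big_nat_recr //= IH; lia.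
Qed.

Lemma sum_nat1 a b : \sum_(a <= i < b) 1 = b - a.
Proof. by rewrite sum_nat_const_nat muln1. Qed.

(** Double counting of the pairs [(v, u)] with [u = phi v]. *)
Lemma sum_transport (P : nat -> nat -> bool) (phi psi : nat -> nat) a b c d :
  (forall u v, (phi v == u) = (psi u == v)) ->
  \sum_(a <= v < b) (P v (phi v) && (c <= phi v < d) : nat) =
  \sum_(c <= u < d) (P (psi u) u && (a <= psi u < b) : nat).
Proof.
move=> E.
have -> : \sum_(a <= v < b) (P v (phi v) && (c <= phi v < d) : nat) =
    \sum_(a <= v < b) \sum_(c <= u < d) ((P v u) * (phi v == u)).
  apply: eq_bigr => v _; rewrite -mulnb -sum_pred1 big_distrr /=.
  by apply: eq_bigr => u _; case: eqP => [->|]; rewrite ?muln0.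
rewrite exchange_big /=; apply: eq_bigr => u _.
rewrite -mulnb -sum_pred1 big_distrr /=.
by apply: eq_bigr => v _; rewrite E; case: eqP => [->|]; rewrite ?muln0.
Qed.

Section Table.
Variables (N : nat) (f : nat -> nat -> nat).
Hypothesis H : settled N f.
Let fC := tableC H.
Let fK := tableK H.

Lemma table_eq x y z : (f x y == z) = (f x z == y).
Proof. by apply/eqP/eqP => <-; rewrite fK. Qed.

Lemma tops_eq0 T s : N <= s -> T.*2 <= s.+2 -> tops f T s = 0.
Proof.
move=> Ns Ts; rewrite /tops big_nat big1 // => t tT.
case: ltnP => // h; have := table_le H Ns (fK t s); lia.
Qed.

(** The map [v |-> f v s] is an involution without fixed points, so each of its
    orbits has exactly one member that is larger than its image. *)
Lemma sum_lower_upper s a b :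
  N <= s ->
  (\sum_(a <= v < b) ((f v s < v) && (a <= f v s < b) : nat)).*2 =
  \sum_(a <= v < b) (a <= f v s < b).
Proof.
move=> Ns; rewrite -addnn.
rewrite {1}(@sum_transport (fun v u => u < v) (fun v => f v s) (fun v => f v s)); last first.
  by move=> u v; rewrite fC table_eq fC.
rewrite -big_split /=; apply: eq_bigr => v _.
have : f v s <> v.
  by move=> E; apply: (@table_diag _ _ H s v Ns); rewrite -{2}E fK.
case: (a <= _ < b); lia.
Qed.

(** Two heaps below [T] that complete [s] sum to at least [s], hence both exceed
    [s - T]; that window has [2T - s - 1] elements, which the involution pairs
    up. *)
Lemma tops_lt T s : N <= s -> T < s -> s < T.*2 -> (tops f T s).*2 + s < T.*2.
Proof.
move=> Ns Ts sT.
have -> : tops f T s = \sum_(s - T + 1 <= v < T) ((f v s < v) && (s - T + 1 <= f v s < T) : nat).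
  rewrite /tops (@big_cat_nat _ _ _ (s - T + 1)) //=; last by lia.
  rewrite [X in X + _]big_nat [X in X + _]big1 ?add0n.
    rewrite big_nat [RHS]big_nat; apply: eq_bigr => v vT.
    have := table_le H Ns (fK v s); case: (ltnP (f v s) v); lia.
  move=> v vT; have := table_le H Ns (fK v s); case: (ltnP (f v s) v); lia.
rewrite sum_lower_upper //.
have : \sum_(s - T + 1 <= v < T) (s - T + 1 <= f v s < T) <= \sum_(s - T + 1 <= v < T) 1.
  by apply: leq_sum => v _; case: (_ <= _ < _).
rewrite sum_nat1; lia.
Qed.

(** The [T] entries of column [T] split into those below [T], which come in
    pairs, those above [T], and the single entry [f 0 T = T]. *)
Lemma tops_mids T : N <= T -> 0 < T -> T = (tops f T T).*2 + mids f T + 1.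
Proof.
move=> NT T0.
have w1 : mids f T = \sum_(0 <= v < T) (T < f v T).
  transitivity (\sum_(T.+1 <= s < T.*2) (true && (0 <= f T s < T) : nat)).
    by apply: eq_bigr => s _; rewrite leq0n.
  rewrite (@sum_transport (fun _ _ => true) (f T) (f T)); last first.
    by move=> u v; rewrite table_eq.
  rewrite big_nat [RHS]big_nat; apply: eq_bigr => v vT /=.
  rewrite [f T v]fC; case: (ltnP T (f v T)) => h /=; last lia.
  have : f v T <= v + T by apply: (table_le H (s := f v T)) => //; lia.
  lia.
have l1 : (tops f T T).*2 = \sum_(0 <= v < T) (0 <= f v T < T).
  rewrite -sum_lower_upper //; congr (_.*2); rewrite /tops big_nat [RHS]big_nat.
  by apply: eq_bigr => v vT; lia.
have e1 : \sum_(0 <= v < T) (T == f v T) = 1.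
  rewrite -(prednK T0) big_nat_recl // (table_row0 H) ?prednK // eqxx big1_seq ?addn0 // => v _.
  apply/eqP; rewrite eqb0; apply/eqP => E.
  have := fK T v.+1; rewrite (fC T v.+1) -E => h.
  have := fK T 0; rewrite (fC T 0) (table_row0 H) // => h2; congruence.
rewrite l1 w1 -[X in _ = _ + X]e1 -!big_split /= -[LHS]subn0 -sum_nat1.
by apply: eq_bigr => v _; case: (ltngtP (f v T) T).
Qed.

(** If row [T] skips column [s] but uses a later column [u], with third heap
    [x < T], the rule at [(x, T)] explains why [s] was not chosen there: [x] must
    already have met [s] below [T].  So [{x, f x s, s}] is a P-position counted
    by [tops f T s], and [u] determines it injectively. *)
Lemma served_hole T s : N <= T -> T < s -> T <= f T s ->
  \sum_(s.+1 <= u < T.*2) (f T u < T) <= tops f T s.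
Proof.
move=> NT Ts hT; have Ns : N <= s by lia.
(* The other outcome of the rule, [f s T < x], is excluded by [T <= f T s]. *)
have low x : x < T -> s < f x T -> f x s < T.
  move=> xT xs; case: (table_mex H (x := x) (y := T) (z := s)) => //.
    by rewrite Ns !orbT.
  rewrite fC; lia.
have -> : \sum_(s.+1 <= u < T.*2) (f T u < T) = \sum_(0 <= x < T) (s < f x T < T.*2).
  transitivity (\sum_(s.+1 <= u < T.*2) (true && (0 <= f T u < T) : nat)).
    by apply: eq_bigr => u _; rewrite leq0n.
  rewrite (@sum_transport (fun _ _ => true) (f T) (f T)); last first.
    by move=> u v; rewrite table_eq.
  by apply: eq_bigr => x _ /=; rewrite fC.
have ki z : f (f z s) s = z by rewrite fC [f z s]fC fK.
(* [j x] is the middle heap of the P-position containing [x] and [s]. *)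
pose j x := maxn x (f x s).
have jP x : x < T -> s < f x T -> j x < T /\ f (j x) s < j x.
  move=> xT xs; have l := low _ xT xs; rewrite /j; split; first by lia.
  have nx : f x s <> x by move=> E; apply: (@table_diag _ _ H s x Ns); rewrite -{2}E fK.
  by case: (ltngtP x (f x s)) => c //; [rewrite ki | lia].
(* If [x] and [y] gave the same P-position, then [f x y = s > T], and the rule
   at [(x, y)] for the value [T] contradicts [s < f x T] and [s < f y T]. *)
have jI x y : x < T -> y < T -> s < f x T -> s < f y T -> j x = j y -> x = y.
  move=> xT yT xs ys E; apply/eqP/negPn/negP => ne.
  have E2 : f x y = s.
    have : x = f y s \/ y = f x s.
      move: E ne; rewrite /j => E /eqP ne.
      case: (leqP x (f x s)) E; case: (leqP y (f y s)) => a b;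
        rewrite ?(maxn_idPl _) ?(maxn_idPr _) //; try lia.
      move=> E; exfalso; apply: ne; by rewrite -(ki x) E ki.
    by case=> ->; rewrite ?fK // fC fK.
  have := table_mex H (x := x) (y := y) (z := T); rewrite NT !orbT E2 (fC T y).
  by move=> /(_ isT Ts); lia.
pose h x := s < f x T < T.*2.
have hP x : x \in [seq x <- iota 0 T | h x] -> x < T /\ s < f x T.
  by rewrite mem_filter mem_iota /h; lia.
have -> : \sum_(0 <= x < T) (s < f x T < T.*2) = size [seq j x | x <- [seq x <- iota 0 T | h x]].
  rewrite size_map size_filter -sum1_count [RHS]big_mkcond /index_iota subn0.
  by apply: eq_bigr => x _; rewrite /h; case: ifP.
have -> : tops f T s = size [seq t <- iota 0 T | f t s < t].
  rewrite size_filter -sum1_count [RHS]big_mkcond /tops /index_iota subn0.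
  by apply: eq_bigr => x _; case: ifP.
apply: uniq_leq_size.
  rewrite map_inj_in_uniq ?filter_uniq ?iota_uniq // => x y /hP[xT xs] /hP[yT ys].
  exact: jI.
move=> _ /mapP[x /hP[xT xs] ->]; rewrite mem_filter mem_iota /=.
by have [-> ->] := jP _ xT xs.
Qed.
End Table.

(** * P-positions as a table *)

(** Used with [c] ranging over the moves available in the other two heaps. *)
Lemma pigeonhole (rel : nat -> nat -> Prop) a K n :
  (forall z, a <= z < a + K -> exists2 c, c < n & rel c z) ->
  (forall c z z', rel c z -> rel c z' -> z = z') -> K <= n.
Proof.
move=> ex fn.
have /boolp.choice[g gP] z : exists c, a <= z < a + K -> c < n /\ rel c z.
  have [/ex[c cn r]|nz] := boolP (a <= z < a + K); first by exists c.
  by exists 0.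
have : size [seq g z | z <- iota a K] <= size (iota 0 n).
  apply: uniq_leq_size => [|c /mapP[z]]; last first.
    by rewrite !mem_iota => /gP[gn _] ->; lia.
  rewrite map_inj_in_uniq ?iota_uniq // => z z'; rewrite !mem_iota => /gP[_ r] /gP[_ r'] E.
  by apply: (fn _ _ _ r); rewrite E.
by rewrite size_map !size_iota.
Qed.

Lemma size_heaps (x y z : nat) : size (seq_mset [:: x; y; z] : {mset nat})%mset == 3.
Proof. by rewrite (perm_size (perm_eq_seq_mset [:: x; y; z])). Qed.

Definition pos x y z : position := exist _ (seq_mset [:: x; y; z]) (size_heaps x y z).

Lemma posC12 x y z : pos x y z = pos y x z.
Proof.
by apply: val_inj; apply/eq_seq_msetP/permP => p /=; rewrite addnCA.
Qed.

Lemma posC23 x y z : pos x y z = pos x z y.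
Proof.
by apply: val_inj; apply/eq_seq_msetP/permP => p /=; rewrite !addn0 [p y + _]addnC.
Qed.

Lemma mem_pos x y z u : (u \in val (pos x y z)) = [|| u == x, u == y | u == z].
Proof. by rewrite (perm_mem (perm_eq_seq_mset [:: x; y; z])) !inE. Qed.

Lemma pos_sorted (A : position) : exists x y z, x <= y <= z /\ A = pos x y z.
Proof.
have sz : size (sort leq (val A)) = 3 by rewrite size_sort; apply/eqP/(valP A).
have : sorted leq (sort leq (val A)) by apply: sort_sorted; exact: leq_total.
have : seq_mset (sort leq (val A)) = val A.
  by rewrite -[RHS]seq_mset_id; apply/eq_seq_msetP; rewrite perm_sort.
case: (sort _ _) sz => [|x [|y [|z []]]] //= _ E /and3P[xy yz _].
by exists x, y, z; rewrite xy yz; split=> //; apply: val_inj.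
Qed.

Lemma pos_inj x y z x' y' z' : x <= y <= z -> x' <= y' <= z' ->
  pos x y z = pos x' y' z' -> [/\ x = x', y = y' & z = z'].
Proof.
move=> h h' /(congr1 val) /= /eq_seq_msetP p.
have : [:: x; y; z] = [:: x'; y'; z'].
  apply: (sorted_eq leq_trans anti_leq) => //=; first by rewrite (andP h).1 (andP h).2.
  by rewrite (andP h').1 (andP h').2.
by case.
Qed.

Lemma child_pos x y a b : y < x -> child (pos x a b) (pos y a b).
Proof.
move=> yx; exists x, y; split=> //=; first by rewrite mem_pos eqxx.
by rewrite !mset_cons msetD1K.
Qed.

Lemma child_posP x y z B : child (pos x y z) B ->
  exists u, [\/ u < x /\ B = pos u y z, u < y /\ B = pos x u z | u < z /\ B = pos x y u].
Proof.
have swap_head (a b c v : nat) : val B = (v +` (val (pos a b c) `\ a))%mset -> B = pos v b c.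
  by move=> E; apply: val_inj; rewrite E /= !mset_cons msetD1K.
case=> a [u [aA ua E]]; exists u; move: aA; rewrite mem_pos => /or3P[] /eqP ea; subst a.
- by apply: Or31; split=> //; apply: (swap_head x y z u).
- by apply: Or32; split=> //; rewrite posC12; apply: (swap_head y x z u); rewrite posC12.
- apply: Or33; split=> //; rewrite posC23 posC12; apply: (swap_head z x y u).
  by rewrite posC12 posC23.
Qed.

Section Outcome.
Variable F : {fset position}.
Let P := P_positions F.
Let p x y z := P (pos x y z).

Lemma third_unique x y z z' : p x y z -> p x y z' -> z = z'.
Proof.
have [_ _ PP _] := P_positionsP F.
have no a b : a < b -> p x y a -> p x y b -> False.
  move=> ab pa pb; apply: (PP _ _ pb _ pa).
  by rewrite (posC23 x y b) (posC12 x b) (posC23 x y a) (posC12 x a); exact: child_pos.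
by move=> pz pz'; case: (ltngtP z z') => // l; [case: (no _ _ l pz pz')|case: (no _ _ l pz' pz)].
Qed.

Lemma winning_move x y z : pos x y z \notin F -> ~ p x y z ->
  exists u, [\/ u < x /\ p u y z, u < y /\ p x u z | u < z /\ p x y u].
Proof.
have [PN _ _ NP] := P_positionsP F.
move=> nF np; have : (P `|` N_positions F) (pos x y z) by rewrite PN /=; exact/negP.
case=> // /NP[B /child_posP[u [] [l ->]] pB]; exists u.
- exact: Or31. - exact: Or32. - exact: Or33.
Qed.

Lemma forbidden_bound : exists B, forall x y z,
  [|| B <= x, B <= y | B <= z] -> pos x y z \notin F.
Proof.
exists (\sum_(A <- F) heap_sum A).+1 => x y z h; apply/negP => xF.
have : heap_sum (pos x y z) <= \sum_(A <- F) heap_sum A.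
  by rewrite (big_rem _ xF) /= leq_addr.
have -> : heap_sum (pos x y z) = x + (y + (z + 0)).
  by rewrite /heap_sum (perm_big _ (perm_eq_seq_mset [:: x; y; z])) /= !big_cons big_nil.
lia.
Qed.

(** If no entry below [a + K] completes [x] and [y], each of the [K] candidates
    has a move to a P-position that changes [x] or [y]; such a
    move is determined by the new value of that heap, and there are [x + y] of
    these. *)
Lemma third_exists_le x y a K :
  (forall z, a <= z < a + K -> pos x y z \notin F) ->
  (forall z, z < a + K -> ~ p x y z) -> K <= x + y.
Proof.
move=> nF np.
apply: (@pigeonhole (fun c z => (c < y /\ p x c z) \/ (y <= c /\ p (c - y) y z)) a).
  move=> z hz; have [|u [] [l pu]] := winning_move (nF z hz); first by apply: np; lia.
  - by exists (y + u); [lia | right; rewrite leq_addr addKn].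
  - by exists u; [lia | left].
  - by case: (np u); [lia |].
by move=> c z z' [] [l pz] [] [l' pz']; try lia; exact: third_unique pz'.
Qed.

Lemma third_exists x y : exists z, p x y z.
Proof.
have [B BF] := forbidden_bound.
apply: contrapT => np.
have : (x + y).+1 <= x + y; last by rewrite ltnn.
apply: (@third_exists_le x y B) => [z hz|z _ pz]; last by apply: np; exists z.
by apply: BF; lia.
Qed.

Definition third x y := projT1 (cid (third_exists x y)).

Lemma thirdP x y z : p x y z <-> third x y = z.
Proof.
have t := projT2 (cid (third_exists x y)); rewrite -/(third x y) in t.
by split=> [pz|<- //]; exact: third_unique pz.
Qed.

(** Far from [F] the excluded-value rule is immediate; the remaining clauses can
    fail only for finitely many values, which the threshold is chosen to
    exceed. *)
Lemma third_settled : exists N, settled N third.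
Proof.
have [B BF] := forbidden_bound.
have tC x y : third x y = third y x by apply/thirdP; rewrite /p posC12; exact/thirdP.
have tK x y : third x (third x y) = y by apply/thirdP; rewrite /p posC23; exact/thirdP.
have mex x y z : [|| B <= x, B <= y | B <= z] -> z < third x y ->
    third x z < y \/ third z y < x.
  move=> h l; have np : ~ p x y z by move=> /thirdP; lia.
  have [u [] [l' /thirdP pu]] := winning_move (BF _ _ _ h) np.
  - by right; rewrite tC; have := tK y u; rewrite (tC y u) pu => ->.
  - by left; rewrite -pu tK.
  - by lia.
have le x y : (B <= x) || (B <= y) -> third x y <= x + y.
  move=> h; rewrite leqNgt; apply/negP => l.
  have : (x + y).+1 <= x + y; last by rewrite ltnn.
  apply: (@third_exists_le x y 0) => z hz; first by apply: BF; lia.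
  by move=> /thirdP; lia.
(* Beyond [N1] row [0] is the identity: an exception [s] has [f 0 s < B]. *)
pose N1 := (B + \sum_(0 <= b < B) third 0 b).+1.
have term n (G : nat -> nat) i : i < n -> G i <= \sum_(0 <= b < n) G b.
  move=> ilt; rewrite (@big_cat_nat _ _ _ i) //=; last lia.
  by rewrite (@big_ltn _ _ _ i) //; lia.
have row0 s : N1 <= s -> third 0 s = s.
  move=> Ns; have := le 0 s; rewrite /N1 in Ns.
  have -> : (B <= 0) || (B <= s) by lia.
  move=> /(_ isT); rewrite add0n leq_eqVlt => /orP[/eqP //|l].
  have Es : third 0 (third 0 s) = s by exact: tK.
  case: (leqP B (third 0 s)) => c; first by have := le 0 (third 0 s); rewrite Es c orbT => /(_ isT); lia.
  by have := term B (third 0) _ c; rewrite Es; lia.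
(* The diagonal entries of [x < N1] and the entries of the square [[0, B)^2] are
   not controlled by [row0] and [le]; [N2] and [N3] exceed them. *)
pose N2 := (N1 + \sum_(0 <= x < N1) third x x).+1.
pose N3 := (N2 + \sum_(0 <= x < B) \sum_(0 <= y < B) third x y).+1.
exists N3; split=> //.
- by move=> x y z h; apply: mex; rewrite /N3 /N2 /N1 in h; lia.
- by move=> s h; apply: row0; rewrite /N3 /N2 in h; lia.
- move=> s x h E; rewrite /N3 /N2 in h; case: (leqP N1 x) => c.
    by have := tK x 0; rewrite (tC x 0) row0 // E; lia.
  by have := term N1 (fun x => third x x) _ c; rewrite E; lia.
- move=> s x y h E; case: (boolP ((B <= x) || (B <= y))) => [c|].
    by rewrite -E; exact: le.
  rewrite negb_or -!ltnNge => /andP[xB yB]; rewrite /N3 in h.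
  have := term B (fun x => \sum_(0 <= y < B) third x y) _ xB.
  by have := term B (third x) _ yB; lia.
Qed.
End Outcome.

(** * The effect of one row on a linear functional *)

Local Open Scope ring_scope.

(** A linear functional of the profile [s |-> tops f T s].  The shift [s - T + i]
    is what makes it evolve simply: when row [T] uses column [s], the indices
    summed for [s] keep their upper end and gain [s - T] at the lower end; when
    it skips [s], the upper end moves down by one as well. *)
Definition charge (R : zmodType) f (del : nat -> nat -> R) T :=
  \sum_(T <= s < T.*2) \sum_(1 <= i < (tops f T s).+1) del s (s - T + i)%N.

Definition used_after f T s := (\sum_(s.+1 <= u < T.*2) (f T u < T))%N.

(** Moving each missing position to the right by the number of chosen
    positions beyond it fills, in order, the end of the interval. *)
Lemma sum_gap (R : zmodType) (A : pred nat) (phi : nat -> R) a n :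
  \sum_(a <= s < a + n | ~~ A s) phi (s + \sum_(s.+1 <= u < a + n) A u)%N =
  \sum_(a + (\sum_(a <= u < a + n) A u)%N <= e < a + n) phi e.
Proof.
elim: n a => [|n IH] a; first by rewrite addn0 !big_geq // leq_addr.
rewrite addnS -addSn.
have -> : (\sum_(a <= u < a.+1 + n) A u = A a + \sum_(a.+1 <= u < a.+1 + n) A u)%N.
  by rewrite big_ltn // ltnS leq_addr.
rewrite [LHS]big_ltn_cond ?ltnS ?leq_addr // addnA IH.
case: (A a) => /=; first by rewrite addn1.
have : (\sum_(a.+1 <= u < a.+1 + n) A u <= \sum_(a.+1 <= u < a.+1 + n) 1)%N.
  by apply: leq_sum => u _; case: (A u).
rewrite sum_nat1 addn0 !addSn => h; rewrite [RHS]big_ltn //; lia.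
Qed.

Section OneRow.
Variables (N : nat) (f : nat -> nat -> nat) (R : zmodType).
Hypothesis H : settled N f.
Implicit Types (del : nat -> nat -> R).

Lemma charge_step_raw del T : (N <= T)%N -> (0 < T)%N ->
  charge f del T.+1 - charge f del T =
  - \sum_(1 <= i < (tops f T T).+1) del T i
  + (\sum_(T.+1 <= s < T.*2) del s (s - T)%N
     - \sum_(T.+1 <= s < T.*2 | (T <= f T s)%N) del s (s - T + tops f T s)%N).
Proof.
move=> NT T0; rewrite /charge.
rewrite doubleS big_nat_recr /=; last by lia.
rewrite big_nat_recr /=; last by lia.
have z s : (T.*2 <= s)%N -> tops f T.+1 s = 0%N by move=> Ts; apply: (tops_eq0 H); lia.
rewrite !z // ![\sum_(1 <= i < 1) _]big_geq // !addr0.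
rewrite [X in _ - X]big_ltn; last lia.
rewrite subnn opprD addrCA; congr (_ + _).
rewrite [X in _ = _ - X]big_mkcond -!sumrB.
rewrite big_nat [RHS]big_nat; apply: eq_bigr => s sT.
have -> : tops f T.+1 s = (tops f T s + (f T s < T))%N by rewrite /tops big_nat_recr.
set r := tops f T s; have -> : (s - T = (s - T.+1).+1)%N by lia.
set c := (s - T.+1)%N.
have tel k : \sum_(1 <= i < k.+1) del s (c + i)%N - \sum_(1 <= i < k.+1) del s (c.+1 + i)%N
    = del s c.+1 - del s (c.+1 + k)%N.
  elim: k => [|k IH]; first by rewrite !big_geq // addn0 !subrr.
  rewrite big_nat_recr //= [X in _ - X]big_nat_recr //= addnS -addSn.
  by rewrite opprD addrACA IH addrA subrK.
case: ltnP => h; last by rewrite addn0 tel.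
by rewrite addn1 subr0 big_nat_recr //= addrAC tel addnS -addSn subrK.
Qed.

(** The skipped columns are matched by [sum_gap] with the last columns before
    [2T]; the forced part is then that of a row using the first [mids f T]
    columns, and each skipped column contributes one bracket. *)
Lemma charge_step del T : (N <= T)%N -> (0 < T)%N ->
  charge f del T.+1 - charge f del T =
  - \sum_(1 <= i < (tops f T T).+1) del T i
  + \sum_(1 <= c < (mids f T).+1) del (T + c)%N c
  - \sum_(T.+1 <= s < T.*2 | (T <= f T s)%N)
      (del s (s - T + tops f T s)%N
       - del (s + used_after f T s)%N (s - T + used_after f T s)%N).
Proof.
move=> NT T0; rewrite charge_step_raw // -addrA; congr (_ + _).
rewrite sumrB opprB [RHS]addrA; congr (_ - _).
pose phi e := del e (e - T)%N.
have E : (T.*2 = T.+1 + T.-1)%N by lia.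
have -> : \sum_(T.+1 <= s < T.*2 | (T <= f T s)%N)
    del (s + used_after f T s)%N (s - T + used_after f T s)%N =
    \sum_(T.+1 + mids f T <= e < T.*2) phi e.
  rewrite /mids E -(@sum_gap _ (fun u => f T u < T)%N).
  rewrite big_nat_cond [RHS]big_nat_cond; apply: eq_big => [s|s /andP[sT _]].
    by rewrite -leqNgt.
  by rewrite /used_after E /phi; congr (del _ _); lia.
have wT : (mids f T < T)%N by have := tops_mids H NT T0; lia.
rewrite (@big_cat_nat _ _ _ (T.+1 + mids f T)) /=; [|lia|lia].
congr (_ + _).
rewrite -(add1n T) big_addn.
rewrite (_ : (1 + T + mids f T - T = (mids f T).+1)%N); last lia.
by apply: eq_bigr => c _; rewrite addnK addnC.
Qed.
End OneRow.

(** * The convex potential and the energy *)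

(** The number of P-positions that have their top in a column skipped by row [T] and
    their middle below [T]; it measures the distance to the forced
    evolution. *)
Definition delays f T := (\sum_(T.+1 <= s < T.*2 | T <= f T s) tops f T s)%N.

Section Potential.
Variable R : realFieldType.

(** The value at [0] is large enough to keep the sequence convex. *)
Definition pot (k : nat) : R := if k is 0 then 2 else k%:R^-1.

Lemma pot_convex k : pot k.+1 - pot k <= pot k.+2 - pot k.+1.
Proof.
case: k => [|k] /=; first by rewrite invr1; lra.
rewrite -subr_ge0; set x : R := k%:R; have x0 : 0 <= x by exact: ler0n.
rewrite -[k.+3]addn3 -[k.+2]addn2 -[k.+1]addn1 !natrD -/x.
have -> : (x + 3)^-1 - (x + 2)^-1 - ((x + 2)^-1 - (x + 1)^-1) =
  2 / ((x + 1) * (x + 2) * (x + 3)).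
  rewrite -[(x + 3)^-1]div1r -[(x + 2)^-1]div1r -[(x + 1)^-1]div1r opprB -!mulNr.
  rewrite !addf_div ?mulf_neq0 ?lt0r_neq0 //; try lra.
  by apply/eqP; rewrite eqr_div ?mulf_neq0 ?lt0r_neq0 //; lra.
by apply: divr_ge0 => //; rewrite !mulr_ge0 //; lra.
Qed.

Lemma pot_slope i j : (0 < i <= j)%N -> pot i - pot i.-1 <= pot j - pot j.-1.
Proof.
case: i => // i; case: j => // j /=; rewrite ltnS => ij.
rewrite -(subnKC ij); elim: (j - i)%N => [|k IH]; rewrite ?addn0 //.
by rewrite addnS; apply: le_trans IH _; exact: pot_convex.
Qed.

Lemma pot_gt0 k : 0 < pot k.
Proof. by case: k => [|k] //=; rewrite invr_gt0 ltr0n. Qed.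

Lemma pot_noninc i j : (i <= j)%N -> pot j <= pot i.
Proof.
move=> ij; rewrite -(subnKC ij); elim: (j - i)%N => [|k IH]; rewrite ?addn0 //.
apply: le_trans IH; rewrite addnS; case: (i + k)%N => [|l] /=; first by rewrite invr1; lra.
by rewrite lef_pV2 ?posrE ?ltr0n // ler_nat.
Qed.

(** This inequality makes the energy decrease.  It fails at [m = 0], where the
    left-hand side is larger by [1]. *)
Lemma pot_halving m : (0 < m)%N -> pot m.*2 + pot m.*2.+1 <= pot m.
Proof.
case: m => // m _; have : pot m.+1.*2.+1 <= pot m.+1.*2 by exact: pot_noninc.
have -> : pot m.+1 = pot m.+1.*2 + pot m.+1.*2; last lra.
have -> : pot m.+1.*2 = m.+1.*2%:R^-1 by [].
by rewrite -muln2 natrM invfM /=; set i := _^-1; lra.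
Qed.

Definition drop k : R := pot k - pot k.+2.

(** Second differences of [1/k] are of order [1/k^3]; this is the source of
    the strict gain in [energy_bracket]. *)
Lemma drop_step k : 4 / (k + 3)%:R ^+ 3 <= drop k - drop k.+1.
Proof.
rewrite /drop; case: k => [|k] /=; first by rewrite invr1 add0n !exprS expr0; lra.
rewrite -subr_ge0; set x : R := k%:R; have x0 : 0 <= x by exact: ler0n.
rewrite addSnnS -[k.+4]addn4 -[k.+3]addn3 -[k.+2]addn2 -[k.+1]addn1 !natrD -/x.
have -> : (x + 1)^-1 - (x + 3)^-1 - ((x + 2)^-1 - (x + 4)^-1) - 4 / (x + 4) ^+ 3 =
  (9 * x ^+ 2 + 50 * x + 68) * 2 / ((x + 1) * (x + 2) * (x + 3) * (x + 4) ^+ 3).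
  rewrite -[(x + 3)^-1]div1r -[(x + 2)^-1]div1r -[(x + 1)^-1]div1r -[(x + 4)^-1]div1r.
  rewrite opprB -!mulNr !addf_div ?mulf_neq0 ?expf_neq0 ?lt0r_neq0 //; try lra.
  by apply/eqP; rewrite eqr_div ?mulf_neq0 ?expf_neq0 ?lt0r_neq0 //; lra.
apply: divr_ge0; first by apply: mulr_ge0 => //; have := sqr_ge0 x; lra.
by rewrite !mulr_ge0 ?exprn_ge0 //; lra.
Qed.

Arguments pot : simpl never.

Lemma drop_gap c r K : (c + r + 2 <= K)%N -> r%:R * (4 / K%:R ^+ 3) <= drop c - drop (c + r).
Proof.
elim: r => [|r IH] cK; first by rewrite addn0 subrr mul0r.
have {}IH := IH ltac:(lia); have := drop_step (c + r)%N.
have : 4 / K%:R ^+ 3 <= 4 / (c + r + 3)%:R ^+ 3 :> R.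
  rewrite ler_pM2l // lef_pV2 ?posrE ?exprn_gt0 ?ltr0n //; try lia.
  by rewrite lerXn2r ?nnegrE // ler_nat; lia.
rewrite -addnS -natr1 mulrDl mul1r; lra.
Qed.

Lemma drop_noninc c d : (c <= d)%N -> drop d <= drop c.
Proof.
move=> cd; rewrite -subr_ge0 -{1}(subnKC cd).
by apply: le_trans (drop_gap (leqnn _)); rewrite mulr_ge0 // divr_ge0 // exprn_ge0.
Qed.

(** The increment from [i - 1] to [i] of [pot i + pot (s.-1 - i.*2)].  For
    [i = s - T + tops f T s] the two arguments are the values of [tops f s s]
    and [mids f s] that result if no row from [T] on skips column [s]. *)
Definition slope s i : R := pot i - pot i.-1 + (pot (s.-1 - i.*2) - pot (s.+1 - i.*2)).

Lemma sum_slope s c r : (0 < s)%N -> ((c + r).*2 <= s.-1)%N ->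
  \sum_(1 <= i < r.+1) slope s (c + i) =
  pot (c + r) - pot c + (pot (s.-1 - (c + r).*2) - pot (s.-1 - c.*2)).
Proof.
move=> s0; elim: r => [|r IH] rs; first by rewrite big_geq // addn0; lra.
rewrite big_nat_recr //= IH; last lia.
rewrite /slope addnS /=.
have -> : (s.+1 - (c + r).+1.*2 = s.-1 - (c + r).*2)%N by lia.
lra.
Qed.

Lemma sum_slope_diag T w : (w < T)%N ->
  \sum_(1 <= c < w.+1) slope (T + c) c =
  pot w - pot 0 + (pot (T.-1 - w) + pot (T - w) - pot T - pot T.-1).
Proof.
elim: w => [|w IH] wT; first by rewrite big_geq // !subn0; lra.
rewrite big_nat_recr //= IH; last lia.
rewrite /slope addnS /=.
have -> : (T + w - w.+1.*2 = T.-1 - w.+1)%N by lia.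
have -> : ((T + w).+2 - w.+1.*2 = T - w)%N by lia.
have -> : (T - w.+1 = T.-1 - w)%N by lia.
lra.
Qed.

Section Lyapunov.
Variables (N : nat) (f : nat -> nat -> nat).
Hypothesis H : settled N f.

(** The table-independent second term is chosen so that the forced part of
    [energy_step] reduces to the three potentials of [pot_halving]. *)
Definition energy T : R := charge f slope T + \sum_(1 <= j < T) pot j.

(** Each column contributes at least [- pot (s - T)]; these terms cancel the
    harmonic sum except for [pot 0]. *)
Lemma energy_ge T : (N <= T)%N -> (0 < T)%N -> - 2 <= energy T.
Proof.
move=> NT T0; rewrite /energy /charge.
have E : - 2 = \sum_(0 <= c < T) - pot c + \sum_(1 <= j < T) pot j :> R.
  by rewrite big_ltn // sumrN -addrA addNr addr0.
rewrite E lerD2r.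
have -> : \sum_(0 <= c < T) - pot c = \sum_(T <= s < T.*2) - pot (s - T).
  by rewrite -{2}[T]add0n -addnn -{4}[T]add0n big_addn addnK; apply: eq_bigr => c _; rewrite addnK.
rewrite big_nat [leRHS]big_nat; apply: ler_sum => s sT.
have l : ((s - T + tops f T s).*2 <= s.-1)%N.
  case: (ltnP T s) => Ts.
    by have := @tops_lt _ _ H T s; lia.
  have -> : s = T by lia.
  by have := tops_mids H NT T0; lia.
rewrite sum_slope //; last lia.
have := pot_gt0 (s - T + tops f T s).
have : pot (s.-1 - (s - T).*2) <= pot (s.-1 - (s - T + tops f T s).*2) by apply: pot_noninc; lia.
lra.
Qed.

(** Both inequalities behind the bracket come from convexity, since
    [used_after f T s <= tops f T s] by the hole lemma; all arguments of [drop]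
    are at most [4T], which gives the constant [16 = 4^3 / 4]. *)
Lemma energy_bracket T s : (N <= T)%N -> (0 < T)%N -> (T < s < T.*2)%N -> (T <= f T s)%N ->
  (tops f T s)%:R / (16 * T%:R ^+ 3) <=
  slope s (s - T + tops f T s) - slope (s + used_after f T s) (s - T + used_after f T s).
Proof.
move=> NT T0 sT hT.
have dr : (used_after f T s <= tops f T s)%N by apply: (served_hole H) => //; lia.
have l : ((tops f T s).*2 + s < T.*2)%N by apply: (tops_lt H); lia.
move: dr l; set d := used_after f T s; set r := tops f T s => dr l.
rewrite /slope.
pose c := (T.*2 - s.+1 - r.*2)%N.
have -> : (s.-1 - (s - T + r).*2 = c)%N by rewrite /c; lia.
have -> : (s.+1 - (s - T + r).*2 = c.+2)%N by rewrite /c; lia.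
have -> : ((s + d).-1 - (s - T + d).*2 = c + (r.*2 - d))%N by rewrite /c; lia.
have -> : ((s + d).+1 - (s - T + d).*2 = (c + (r.*2 - d)).+2)%N by rewrite /c; lia.
rewrite -!/(drop _).
have h1 : pot (s - T + d) - pot (s - T + d).-1 <= pot (s - T + r) - pot (s - T + r).-1.
  by apply: pot_slope; lia.
have h2 : drop (c + (r.*2 - d)) <= drop (c + r) by apply: drop_noninc; lia.
have h3 : r%:R * (4 / (4 * T)%:R ^+ 3) <= drop c - drop (c + r).
  by apply: drop_gap; rewrite /c; lia.
have e : r%:R * (4 / (4 * T)%:R ^+ 3) = r%:R / (16 * T%:R ^+ 3) :> R.
  by rewrite natrM exprMn !invfM; lra.
rewrite e in h3; lra.
Qed.

Lemma energy_step T : (N <= T)%N -> (0 < T)%N ->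
  energy T.+1 - energy T + (delays f T)%:R / (16 * T%:R ^+ 3) <=
  pot (tops f T T).*2 + pot (tops f T T).*2.+1 - pot (tops f T T).
Proof.
move=> NT T0; rewrite /energy big_nat_recr //=.
have := charge_step H slope NT T0.
set B := (X in _ = _ - X) => E.
have : (delays f T)%:R / (16 * T%:R ^+ 3) <= B.
  rewrite /delays natr_sum mulr_suml /B big_nat_cond [leRHS]big_nat_cond.
  by apply: ler_sum => s /andP[sT hT]; exact: energy_bracket.
have wm := tops_mids H NT T0.
move: E; rewrite sum_slope_diag; last lia.
have := @sum_slope T 0 (tops f T T) T0; rewrite !add0n double0 subn0 => ->; last lia.
have -> : (T.-1 - mids f T = (tops f T T).*2)%N by lia.
have -> : (T - mids f T = (tops f T T).*2.+1)%N by lia.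
have -> : (T.-1 - (tops f T T).*2 = mids f T)%N by lia.
lra.
Qed.

(** The energy decreases by at least the summand at each row, and never falls
    below [-2]. *)
Lemma delays_summable M : (N <= M)%N -> (0 < M)%N ->
  (forall T, (M <= T)%N -> (0 < tops f T T)%N) ->
  forall X, \sum_(M <= T < X) (delays f T)%:R / (16 * T%:R ^+ 3) <= energy M + 2.
Proof.
move=> NM M0 mpos X; case: (leqP M X) => MX; last first.
  rewrite big_geq; last lia.
  by have := energy_ge NM M0; lra.
suff : \sum_(M <= T < X) (delays f T)%:R / (16 * T%:R ^+ 3) <= energy M - energy X.
  by have := @energy_ge X ltac:(lia) ltac:(lia); lra.
rewrite -[leRHS]opprB -(telescope_sumr _ MX) -sumrN.
rewrite big_nat [leRHS]big_nat; apply: ler_sum => T MTX.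
have := @energy_step T ltac:(lia) ltac:(lia).
have := pot_halving (mpos T ltac:(lia)); lra.
Qed.

(** The energy can increase only at a row with [tops f T T = 0], and then by
    at most [1]. *)
Lemma energy_gap h h' : (N <= h < h')%N -> (0 < h)%N ->
  (forall T, (h < T < h')%N -> (0 < tops f T T)%N) -> energy h' <= energy h + 1.
Proof.
move=> hh h0 mpos.
have le1 T : (N <= T)%N -> (0 < T)%N -> energy T.+1 <= energy T + (tops f T T == 0%N)%:R.
  move=> NT T0; have := energy_step NT T0.
  have : 0 <= (delays f T)%:R / (16 * T%:R ^+ 3) :> R.
    by rewrite divr_ge0 ?mulr_ge0 ?exprn_ge0.
  case: (posnP (tops f T T)) => [->|m0].
    by rewrite [pot 0.*2.+1]/pot double0 invr1 /=; lra.
  by have := pot_halving m0; rewrite ?(negbTE (lt0n_neq0 m0)) /=; lra.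
have h1 : energy h.+1 <= energy h + 1.
  have := le1 h ltac:(lia) h0; case: eqP => _ /=; lra.
have E : (h' = h.+1 + (h' - h.+1))%N by lia.
rewrite E; have : (h.+1 + (h' - h.+1) <= h')%N by lia.
elim: (h' - h.+1)%N => [|k IH] hk; first by rewrite addn0.
rewrite addnS; apply: le_trans (le1 _ _ _) _; [lia|lia|].
have := mpos (h.+1 + k)%N ltac:(lia); rewrite lt0n => /negbTE -> /=.
have := IH ltac:(lia); lra.
Qed.
End Lyapunov.
End Potential.

(** * The ramp functional and approximate doubling *)

Lemma sum_nat_window n a b : (b <= n)%N -> (\sum_(0 <= T < n) (a <= T < b) = b - a)%N.
Proof.
have -> : (\sum_(0 <= T < n) (a <= T < b) = minn b n - a)%N; last lia.
elim: n => [|n IH]; first by rewrite big_geq // minn0.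
by rewrite big_nat_recr //= IH; lia.
Qed.

(** The number of P-positions with distinct heaps and largest heap [T]. *)
Definition tally f T := tops f T T.
Definition total (m : nat -> nat) Y := (\sum_(0 <= T < Y) m T)%N.
(** The sum of [total m] over [1, ..., Y].  Unlike [total], it pairs [m] with a
    Lipschitz function of [T], which the error estimates require. *)
Definition weighted (R : realFieldType) m Y : R := \sum_(0 <= T < Y) (m T * (Y - T))%N%:R.

Section Transfer.
Variables (R : realFieldType) (X : nat).

Definition ramp s : R := (X - s)%N%:R.

(** Chosen so that the forced part of a row closes up: with [T = 2m + w + 1],
    the ramp sum in [sum_ramp_charge_diag] stops at index [T + 1 + w = 2 (T - m)],
    where the one in [sum_ramp_charge] starts, and they join into [spread T]. *)
Definition ramp_charge s i : R := ramp s - (ramp (s - i).*2 + ramp (s - i).*2.+1).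

Lemma ramp_ge0 s : 0 <= ramp s. Proof. exact: ler0n. Qed.

Lemma ramp_le s : ramp s <= X%:R. Proof. by rewrite ler_nat leq_subr. Qed.

Lemma ramp_lip s d : ramp (s + d) <= ramp s <= ramp (s + d) + d%:R.
Proof. by rewrite /ramp -natrD !ler_nat; lia. Qed.

Lemma ramp_eq0 s : (X <= s)%N -> ramp s = 0.
Proof. by rewrite /ramp -subn_eq0 => /eqP ->. Qed.

Lemma sum_even_odd (phi : nat -> R) a b :
  \sum_(a <= i < b) (phi i.*2 + phi i.*2.+1) = \sum_(a.*2 <= j < b.*2) phi j.
Proof.
elim: b => [|b IH]; first by rewrite !big_geq.
case: (leqP a b) => ab; last by rewrite !big_geq //; lia.
rewrite big_nat_recr //= IH doubleS big_nat_recr; last by rewrite /= ; lia.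
by rewrite big_nat_recr /=; [rewrite addrA | lia].
Qed.

(** Index [j] lies strictly between [T] and [2T] for about [j / 2] values of [T],
    which is what the subtracted term provides; the two differ by one term for
    odd [j]. *)
Lemma sum_doubling_gap (phi : nat -> R) n : (forall j, (n <= j)%N -> phi j = 0) ->
  \sum_(0 <= T < n) (\sum_(T.+1 <= j < T.*2) phi j
     - (phi T.*2 + phi T.*2.+1) *+ T.-1) = \sum_(1 <= T < n) phi T.*2.+1.
Proof.
move=> phi0.
have E1 : \sum_(0 <= T < n) \sum_(T.+1 <= j < T.*2) phi j =
    \sum_(0 <= j < n.*2) phi j *+ (j.-1)./2.
  transitivity (\sum_(0 <= T < n) \sum_(0 <= j < n.*2) phi j *+ (T < j < T.*2)%N).
    rewrite big_nat [RHS]big_nat; apply: eq_bigr => T Tn.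
    rewrite (@big_nat_widenl _ _ _ _ 0) // (@big_nat_widen _ _ _ _ _ n.*2); last lia.
    rewrite big_mkcond; apply: eq_bigr => j _; rewrite -mulrb andTb.
    by congr (_ *+ nat_of_bool _); lia.
  rewrite exchange_big_nat /= big_nat [RHS]big_nat; apply: eq_bigr => j jn.
  case: (leqP n j) => nj; first by rewrite phi0 // mul0rn big1 // => T _; rewrite mul0rn.
  rewrite sumrMnr; congr (_ *+ _).
  transitivity (\sum_(0 <= T < n) (j./2.+1 <= T < j))%N.
    by apply: eq_bigr => T _; congr nat_of_bool; lia.
  by rewrite sum_nat_window; lia.
rewrite sumrB E1; have := sum_even_odd (fun j => phi j *+ (j.-1)./2) 0 n.
rewrite double0 => <-; rewrite -sumrB.
case: n phi0 E1 => [|n] phi0 _; first by rewrite !big_geq.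
rewrite big_ltn // double0 /= !mulr0n addr0 subr0 add0r.
rewrite big_nat [RHS]big_nat; apply: eq_bigr => T T0.
have -> : ((T.*2.-1)./2 = T.-1)%N by lia.
have -> : (T.*2./2 = T.-1.+1)%N by lia.
by rewrite mulrnDl mulrS; lra.
Qed.

Variables (N : nat) (f : nat -> nat -> nat).
Hypothesis H : settled N f.

Lemma tops_le T s : (tops f T s <= T)%N.
Proof.
rewrite /tops; apply: leq_trans (_ : (\sum_(0 <= t < T) 1 <= T)%N); last by rewrite sum_nat1 subn0.
by apply: leq_sum => t _; case: (_ < _)%N.
Qed.

Lemma sum_ramp_charge T m : (m <= T)%N ->
  \sum_(1 <= i < m.+1) ramp_charge T i =
  ramp T *+ m - \sum_((T - m).*2 <= j < T.*2) ramp j.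
Proof.
elim: m => [|m IH] mT; first by rewrite subn0 !big_geq // mulr0n subr0.
rewrite big_nat_recr //= IH; last lia.
rewrite (@big_cat_nat _ _ _ (T - m).*2 (T - m.+1).*2) //=; try lia.
have -> : ((T - m).*2 = (T - m.+1).*2.+2)%N by lia.
rewrite [X in _ - (X + _)]big_ltn // [X in _ - (_ + X + _)]big_ltn //.
rewrite [X in _ - (_ + (_ + X) + _)]big_geq //.
by rewrite /ramp_charge mulrSr; lra.
Qed.

Lemma sum_ramp_charge_diag T w :
  \sum_(1 <= c < w.+1) ramp_charge (T + c) c =
  \sum_(T.+1 <= j < T.+1 + w) ramp j - (ramp T.*2 + ramp T.*2.+1) *+ w.
Proof.
elim: w => [|w IH]; first by rewrite addn0 !big_geq // mulr0n subr0.
have E : \sum_(T.+1 <= j < T.+1 + w.+1) ramp j = \sum_(T.+1 <= j < T.+1 + w) ramp j + ramp (T.+1 + w).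
  by rewrite addnS big_nat_recr // leq_addr.
rewrite big_nat_recr //= IH E addnS.
by rewrite /ramp_charge subSS addnK addSn mulrSr /=; lra.
Qed.

(** Here the ramp being Lipschitz replaces the convexity used in
    [energy_bracket]. *)
Lemma ramp_bracket T s : (N <= T)%N -> (T < s < T.*2)%N -> (T <= f T s)%N ->
  `|ramp_charge s (s - T + tops f T s)
    - ramp_charge (s + used_after f T s) (s - T + used_after f T s)| <= 5 * (tops f T s)%:R.
Proof.
move=> NT sT hT.
have dr : (used_after f T s <= tops f T s)%N by apply: (served_hole H) => //; lia.
have l : ((tops f T s).*2 + s < T.*2)%N by apply: (tops_lt H); lia.
move: dr l; set d := used_after f T s; set r := tops f T s => dr l.
rewrite /ramp_charge.
have -> : (s - (s - T + r) = T - r)%N by lia.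
have -> : (s + d - (s - T + d) = T)%N by lia.
have /andP[a1 a2] := ramp_lip s d.
have /andP[b1 b2] := ramp_lip (T - r).*2 r.*2.
have /andP[c1 c2] := ramp_lip (T - r).*2.+1 r.*2.
move: b1 b2 c1 c2; rewrite addSn (_ : ((T - r).*2 + r.*2 = T.*2)%N); last lia.
have e : r.*2%:R = 2 * r%:R :> R by rewrite -mul2n natrM.
have : d%:R <= r%:R :> R by rewrite ler_nat.
rewrite e ler_norml; lra.
Qed.

Definition spread T : R := \sum_(T.+1 <= j < T.*2) ramp j.

Lemma ramp_step T : (N <= T)%N -> (0 < T)%N ->
  `|charge f ramp_charge T.+1 - charge f ramp_charge T
    + (ramp T *+ tops f T T - spread T + (ramp T.*2 + ramp T.*2.+1) *+ mids f T)|
  <= 5 * (delays f T)%:R.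
Proof.
move=> NT T0; rewrite (charge_step H) //.
have wm := tops_mids H NT T0.
rewrite sum_ramp_charge ?tops_le // sum_ramp_charge_diag.
have -> : \sum_((T - tops f T T).*2 <= j < T.*2) ramp j =
    spread T - \sum_(T.+1 <= j < T.+1 + mids f T) ramp j.
  have -> : spread T = \sum_(T.+1 <= j < T.+1 + mids f T) ramp j +
      \sum_(T.+1 + mids f T <= j < T.*2) ramp j.
    by rewrite /spread (@big_cat_nat _ _ _ (T.+1 + mids f T)) //=; lia.
  have -> : (T.+1 + mids f T = (T - tops f T T).*2)%N by lia.
  by lra.
set B := (X in _ + _ - X + _).
have -> : - (ramp T *+ tops f T T - (spread T - \sum_(T.+1 <= j < T.+1 + mids f T) ramp j)) +
  (\sum_(T.+1 <= j < T.+1 + mids f T) ramp j - (ramp T.*2 + ramp T.*2.+1) *+ mids f T) - B +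
  (ramp T *+ tops f T T - spread T + (ramp T.*2 + ramp T.*2.+1) *+ mids f T) = - B by lra.
rewrite normrN /B /delays natr_sum mulr_sumr; apply: le_trans (ler_norm_sum _ _ _) _.
rewrite big_nat_cond [leRHS]big_nat_cond; apply: ler_sum => s /andP[sT hT].
exact: ramp_bracket.
Qed.

Lemma ramp_charge_le s i : `|ramp_charge s i| <= 2 * X%:R.
Proof.
rewrite /ramp_charge ler_norml.
have := ramp_ge0 s; have := ramp_le s.
have := ramp_ge0 (s - i).*2; have := ramp_le (s - i).*2.
have := ramp_ge0 (s - i).*2.+1; have := ramp_le (s - i).*2.+1; lra.
Qed.

Lemma charge_ramp_le T : `|charge f ramp_charge T| <= (T ^ 2)%N%:R * (2 * X%:R).
Proof.
rewrite /charge; apply: le_trans (ler_norm_sum _ _ _) _.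
apply: (@le_trans _ _ (\sum_(T <= s < T.*2) T%:R * (2 * X%:R))); last first.
  have -> : (T ^ 2)%N%:R * (2 * X%:R) = T%:R * (2 * X%:R) *+ T :> R by rewrite natrX -[RHS]mulr_natr; lra.
  by rewrite sumr_const_nat -addnn addnK.
apply: ler_sum => s _; apply: le_trans (ler_norm_sum _ _ _) _.
apply: (@le_trans _ _ (\sum_(1 <= i < (tops f T s).+1) 2 * X%:R)).
  by apply: ler_sum => i _; exact: ramp_charge_le.
rewrite sumr_const_nat subn1 /= -[leLHS]mulr_natr [leLHS]mulrC ler_wpM2r ?mulr_ge0 //.
by rewrite ler_nat tops_le.
Qed.

Lemma charge_ramp_eq0 T : (N <= T)%N -> (0 < T)%N -> (X <= T)%N -> charge f ramp_charge T = 0.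
Proof.
move=> NT T0 XT; rewrite /charge big_nat big1 // => s sT; rewrite big_nat big1 // => i il.
have l : ((tops f T s).*2 < T)%N.
  case: (ltnP T s) => Ts.
    by have := @tops_lt _ _ H T s; lia.
  have -> : s = T by lia.
  by have := tops_mids H NT T0; lia.
rewrite /ramp_charge !ramp_eq0 ?addr0 ?subr0 //; lia.
Qed.

(** For [X = 2Y] the sum of these terms is [weighted R (tally f) X] minus
    [8 * weighted R (tally f) Y], up to the rounding in [ramp T.*2.+1]. *)
Definition main_term T : R := ramp T *+ tops f T T - (ramp T.*2 + ramp T.*2.+1) *+ (tops f T T).*2.
(** What the forced evolution leaves once the counts are removed. *)
Definition free_term T : R := spread T - (ramp T.*2 + ramp T.*2.+1) *+ T.-1.

Lemma sum_main_free M : (N <= M)%N -> (0 < M)%N -> (M <= X)%N ->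
  `|\sum_(M <= T < X) (main_term T - free_term T)|
   <= (M ^ 2)%N%:R * (2 * X%:R) + 5 * \sum_(M <= T < X) (delays f T)%:R.
Proof.
move=> NM M0 MX.
have tel : \sum_(M <= T < X) (charge f ramp_charge T.+1 - charge f ramp_charge T)
    = - charge f ramp_charge M.
  by rewrite telescope_sumr // (charge_ramp_eq0 (T := X)) ?sub0r //; lia.
have -> : \sum_(M <= T < X) (main_term T - free_term T) = charge f ramp_charge M +
   \sum_(M <= T < X) (charge f ramp_charge T.+1 - charge f ramp_charge T + (main_term T - free_term T)).
  by rewrite [X in _ = _ + X]big_split /= tel addrA subrr add0r.
apply: le_trans (ler_normD _ _) _; apply: lerD; first exact: charge_ramp_le.
apply: le_trans (ler_norm_sum _ _ _) _; rewrite mulr_sumr.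
rewrite big_nat [leRHS]big_nat; apply: ler_sum => T MT.
have T0 : (0 < T)%N by lia. have NT : (N <= T)%N by lia.
suff -> : main_term T - free_term T = ramp T *+ tops f T T - spread T
    + (ramp T.*2 + ramp T.*2.+1) *+ mids f T by exact: ramp_step.
rewrite /main_term /free_term.
have -> : (T.-1 = (tops f T T).*2 + mids f T)%N by have := tops_mids H NT T0; lia.
by rewrite mulrnDr; lra.
Qed.

Lemma main_free_le M T : (T < M)%N ->
  `|main_term T| <= 4 * (M%:R * X%:R) /\ `|free_term T| <= 2 * (M%:R * X%:R).
Proof.
move=> TM.
have lM : (tops f T T <= M)%N by have := tops_le T T; lia.
have n2 : ((tops f T T).*2 <= 2 * M)%N by lia.
have n3 : (T.-1 <= M)%N by lia.
have n4 : (T.*2 - T.+1 <= M)%N by lia.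
have a := ramp_ge0 T; have b := ramp_le T.
have a2 := ramp_ge0 T.*2; have b2 := ramp_le T.*2.
have a3 := ramp_ge0 T.*2.+1; have b3 := ramp_le T.*2.+1.
have x0 : 0 <= X%:R :> R by [].
have bnd (y : R) k c : (k <= c)%N -> 0 <= y -> y *+ k <= c%:R * y.
  by move=> kc y0; rewrite -[leLHS]mulr_natl ler_wpM2r // ler_nat.
have MX : 0 <= M%:R * X%:R :> R by rewrite mulr_ge0.
have e2 : (2 * M)%N%:R = 2 * M%:R :> R by rewrite natrM.
have s2 : 0 <= ramp T.*2 + ramp T.*2.+1 <= 2 * X%:R by lra.
have m1 : 0 <= ramp T *+ tops f T T <= M%:R * X%:R.
  rewrite mulrn_wge0 //=; apply: le_trans (bnd _ _ _ lM a) _; exact: ler_wpM2l.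
have up k c : (k <= c)%N -> 0 <= (ramp T.*2 + ramp T.*2.+1) *+ k <= c%:R * (2 * X%:R).
  move=> kc; rewrite mulrn_wge0 //=; last lra.
  by apply: le_trans (bnd _ _ _ kc _) _; [lra | apply: ler_wpM2l => //; lra].
have sp : 0 <= spread T <= M%:R * X%:R.
  apply/andP; split; first by apply: sumr_ge0 => j _; exact: ramp_ge0.
  apply: (@le_trans _ _ (\sum_(T.+1 <= j < T.*2) X%:R)).
    by apply: ler_sum => j _; exact: ramp_le.
  by rewrite sumr_const_nat; exact: bnd.
have := up _ _ n2; have := up _ _ n3.
by rewrite e2 /main_term /free_term !ler_norml; split; lra.
Qed.
End Transfer.

Section Doubling.
Variable R : realFieldType.

(** Apply the ramp functional with [X = 2Y].  Below [N] nothing is known of the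
    table and trivial bounds are used; above, [sum_main_free] compares with
    the free terms, whose sum is small by [sum_doubling_gap]. *)
Lemma weighted_doubling N f Y : settled N f -> (0 < N <= Y)%N ->
  `|weighted R (tally f) Y.*2 - 8 * weighted R (tally f) Y| <=
  (16 * N ^ 2 + 6)%N%:R * (Y ^ 2)%N%:R + 5 * \sum_(N <= T < Y.*2) (delays f T)%:R.
Proof.
move=> H NY; set X := Y.*2.
have E : weighted R (tally f) X - 8 * weighted R (tally f) Y =
    \sum_(0 <= T < N) main_term R X f T - \sum_(0 <= T < N) free_term R X T
    + \sum_(N <= T < X) (main_term R X f T - free_term R X T)
    + \sum_(0 <= T < X) free_term R X T
    - \sum_(0 <= T < X) (2 * tops f T T * (T < Y))%N%:R.
  have -> : weighted R (tally f) Y = \sum_(0 <= T < X) (tops f T T * (Y - T))%N%:R.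
    rewrite /weighted [RHS](@big_cat_nat _ _ _ Y) //=; last by rewrite /X; lia.
    rewrite [X in _ = _ + X]big_nat [X in _ = _ + X]big1 ?addr0 // => T YT.
    rewrite (_ : (Y - T = 0)%N) ?muln0 //; lia.
  have -> : \sum_(N <= T < X) (main_term R X f T - free_term R X T) =
    \sum_(N <= T < X) main_term R X f T - \sum_(N <= T < X) free_term R X T by rewrite -sumrB.
  set A := \sum_(0 <= T < N) main_term R X f T.
  set B := \sum_(0 <= T < N) free_term R X T.
  have -> : \sum_(0 <= T < X) free_term R X T = B + \sum_(N <= T < X) free_term R X T.
    by rewrite [LHS](@big_cat_nat _ _ _ N) //=; rewrite /X; lia.
  transitivity (A + \sum_(N <= T < X) main_term R X f T
    - \sum_(0 <= T < X) (2 * tops f T T * (T < Y))%N%:R); last by lra.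
  rewrite -(@big_cat_nat _ _ _ N) //=; last by rewrite /X; lia.
  rewrite /weighted /tally mulr_sumr -!sumrB; apply: eq_bigr => T _.
  have nat_act k (y : R) : y *+ k = k%:R * y by rewrite mulr_natl.
  rewrite /main_term (nat_act (tops f T T)) (nat_act (tops f T T).*2) /ramp -mul2n !natrM.
  case: (ltnP T Y) => TY.
    have -> : (X - T.*2 = 2 * (Y - T))%N by rewrite /X; lia.
    have -> : (X - T.*2.+1)%N%:R = (2 * (Y - T))%N%:R - 1 :> R.
      by rewrite -[1]/(1%:R) -natrB; [congr (_%:R); rewrite /X; lia | lia].
  by rewrite /= ?mulr0n ?mulr0; lra.
  have -> : (X - T.*2 = 0)%N by rewrite /X; lia.
  have -> : (X - T.*2.+1 = 0)%N by rewrite /X; lia.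
  have -> : (Y - T = 0)%N by lia.
  by rewrite mulr0 /=; lra.
rewrite E.
have N0 : (0 < N)%N by lia.
have h1 := @sum_main_free R X N f H N (leqnn N) N0 ltac:(rewrite /X; lia).
have h2 : `|\sum_(0 <= T < N) main_term R X f T| <= N%:R * (4 * (N%:R * X%:R)).
  apply: le_trans (ler_norm_sum _ _ _) _.
  rewrite -[N in leRHS]subn0 mulr_natl -sumr_const_nat !subn0 big_nat [leRHS]big_nat.
  by apply: ler_sum => T TN; have [] := @main_free_le R X f N T ltac:(lia).
have h3 : `|\sum_(0 <= T < N) free_term R X T| <= N%:R * (2 * (N%:R * X%:R)).
  apply: le_trans (ler_norm_sum _ _ _) _.
  rewrite -[N in leRHS]subn0 mulr_natl -sumr_const_nat !subn0 big_nat [leRHS]big_nat.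
  by apply: ler_sum => T TN; have [] := @main_free_le R X f N T ltac:(lia).
have h4 : `|\sum_(0 <= T < X) free_term R X T| <= X%:R * X%:R.
  rewrite /free_term sum_doubling_gap => [|j]; last exact: ramp_eq0.
  apply: le_trans (ler_norm_sum _ _ _) _.
  apply: (@le_trans _ _ (\sum_(1 <= T < X) X%:R)).
    by apply: ler_sum => T _; rewrite ger0_norm ?ramp_ge0 ?ramp_le.
  by rewrite sumr_const_nat -[leLHS]mulr_natl ler_wpM2r // ler_nat; lia.
have h5 : `|\sum_(0 <= T < X) (2 * tops f T T * (T < Y))%N%:R| <= 2 * (Y%:R * Y%:R) :> R.
  rewrite -natr_sum normr_nat -!natrM ler_nat.
  rewrite (@big_cat_nat _ _ _ Y) //=; last by rewrite /X; lia.
  rewrite [X in (_ + X <= _)%N]big_nat [X in (_ + X <= _)%N]big1 ?addn0; last first.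
    by move=> T; case: ltnP => //; rewrite ?muln0 //; lia.
  apply: (@leq_trans (\sum_(0 <= T < Y) 2 * Y)).
    rewrite big_nat [X in (_ <= X)%N]big_nat; apply: leq_sum => T TY.
    by have := tops_le f T T; case: (T < Y)%N; lia.
  by rewrite sum_nat_const_nat subn0; lia.
have XE : X%:R = 2 * Y%:R :> R by rewrite /X -mul2n natrM.
have Y1 : 1 <= Y%:R :> R by rewrite ler1n; lia.
have N2 : 0 <= (N ^ 2)%N%:R :> R by [].
have XY : (N ^ 2)%N%:R * X%:R <= 2 * ((N ^ 2)%N%:R * (Y ^ 2)%N%:R) :> R.
  by rewrite XE natrX; nra.
move: h1 h2 h3 h4 h5 XY; rewrite !natrX !natrD !natrM XE ?natrX.
set a := \sum_(0 <= T < N) main_term R X f T.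
set b := \sum_(0 <= T < N) free_term R X T.
set c := \sum_(N <= T < X) (main_term R X f T - free_term R X T).
set d := \sum_(0 <= T < X) free_term R X T.
set e := \sum_(0 <= T < X) _.
move=> h1 h2 h3 h4 h5 XY.
have := ler_normB (a - b + c + d) e; have := ler_normD (a - b + c) d.
have := ler_normD (a - b) c; have := ler_normB a b.
lra.
Qed.
End Doubling.

(** * From doubling to convergence *)

Lemma ramp_scaling (F : realFieldType) (x y n D D0 : F) : y != 0 ->
  y / n * (D / x ^+ 3 / y ^+ 3 - D0 / (x * y) ^+ 3) = (D - D0) / (n * x * (x * y) ^+ 2).
Proof.
move=> y0; have : y / y = 1 by rewrite divff.
rewrite !exprMn !invfM; set xi := x^-1; set yi := y^-1; set ni := n^-1 => E.
transitivity ((D - D0) * ni * xi ^+ 3 * (y * yi) * yi ^+ 2); first lra.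
by rewrite E; lra.
Qed.

Section Limits.
Variable R : realType.

Lemma cvg_bounded_variation (u : nat -> R) (B : R) :
  (forall K, \sum_(0 <= k < K) `|u k.+1 - u k| <= B) -> cvgn u.
Proof.
move=> bv.
have cs : cvgn (series (telescope u)).
  apply: normed_cvg; apply: nondecreasing_is_cvgn.
    by apply: nondecreasing_series => k _ _; rewrite /= normr_ge0.
  by exists B => _ [K _ <-]; exact: bv.
have -> : u = (fun n => u 0%N + series (telescope u) n).
  by apply/funext => n; exact: eq_sum_telescope.
by apply: is_cvgD => //; exact: is_cvg_cst.
Qed.

Lemma cvg_approx (x : nat -> R) :
  (forall e, 0 < e -> exists2 v : nat -> R, cvgn v & \forall k \near \oo, `|x k - v k| <= e) ->
  cvgn x.
Proof.
move=> ap; apply/cauchy_cvgP/cauchy_exP => e e0.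
have e40 : 0 < e / 4 by rewrite divr_gt0.
have [v cv xv] := ap _ e40.
exists (limn v); rewrite /fmap /=.
have cl := (@cvgrPdist_le _ _ _ _ _ _ _).1 cv _ e40.
near=> k; rewrite /ball /=.
have a : `|x k - v k| <= e / 4 by near: k; exact: xv.
have b : `|limn v - v k| <= e / 4 by near: k; exact: cl.
have := ler_distD (v k) (limn v) (x k); rewrite (distrC (v k)); lra.
Unshelve. all: by end_near. Qed.

Section Sandwich.
Variable m : nat -> nat.
Hypothesis m_le : forall T, (m T <= T)%N.

Lemma weightedS Y : weighted R m Y.+1 = weighted R m Y + (total m Y.+1)%:R.
Proof.
rewrite /weighted /total natr_sum !big_nat_recr //= subSnn muln1 addrA; congr (_ + _).
rewrite -big_split /= big_nat [RHS]big_nat; apply: eq_bigr => T TY.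
by rewrite -natrD; congr (_%:R); rewrite subSn ?mulnS 1?addnC //; lia.
Qed.

Lemma total_bounds N a : (total m N <= total m (N + a) <= total m N + a * (N + a))%N.
Proof.
have -> : (total m (N + a) = total m N + \sum_(N <= T < N + a) m T)%N.
  by rewrite /total [LHS](@big_cat_nat _ _ _ N) ?leq_addr.
rewrite leq_addr leq_add2l /=.
apply: (@leq_trans (\sum_(N <= T < N + a) (N + a)))%N; last first.
  by rewrite sum_nat_const_nat; lia.
by rewrite big_nat [X in (_ <= X)%N]big_nat; apply: leq_sum => T ?; have := m_le T; lia.
Qed.

(** The increments of [weighted R m] are the values of [total m], which is
    monotone with increments [m T <= T]. *)
Lemma weighted_bounds N a :
  (a * total m N)%N%:R <= weighted R m (N + a) - weighted R m N
  <= (a * total m N + a ^ 2 * (N + a))%N%:R.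
Proof.
elim: a => [|a /andP[l u]]; first by rewrite addn0 subrr lexx.
rewrite addnS weightedS; have /andP[l1 u1] := total_bounds N a.+1.
move: l1 u1; rewrite addnS => l1 u1.
have l2 : (a.+1 * total m N)%N%:R <= (a * total m N)%N%:R + (total m (N + a).+1)%:R :> R.
  by rewrite -natrD ler_nat; lia.
have u2 : (a * total m N + a ^ 2 * (N + a))%N%:R + (total m (N + a).+1)%:R
    <= (a.+1 * total m N + a.+1 ^ 2 * (N + a).+1)%N%:R :> R.
  by rewrite -natrD ler_nat; nia.
lra.
Qed.

(** The difference quotient of [weighted R m] over a window of relative length
    [2^-j] equals [total m] up to a relative error of order [2^-j], and it
    converges along [n 2^k] because [n] and [n (2^j + 1)] are both admissible
    starting points. *)
Lemma total_cvg M :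
  (forall n, (M <= n)%N -> (0 < n)%N -> cvgn (fun k => weighted R m (n * 2 ^ k) / 8 ^+ k)) ->
  forall n, (M <= n)%N -> (0 < n)%N -> cvgn (fun k => (total m (n * 2 ^ k))%:R / 4 ^+ k : R).
Proof.
move=> cW n Mn n0; apply: cvg_approx => e e0.
have [j jP] : exists j, 2 * n%:R ^+ 2 / 2 ^+ j <= e.
  (* [2 n^2 / 2^j] bounds the error made by the window of length [n 2^(k-j)]. *)
  exists (Num.truncn (2 * n%:R ^+ 2 / e)).+1.
  set t := 2 * n%:R ^+ 2 / e; have t0 : 0 <= t by rewrite divr_ge0 ?mulr_ge0 ?exprn_ge0 // ltW.
  have tj : t <= 2 ^+ (Num.truncn t).+1.
    apply: ltW; apply: lt_trans (truncnS_gt t) _; rewrite -natrX ltr_nat.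
    exact: ltn_expl.
  rewrite ler_pdivrMr ?exprn_gt0 // -/t.
  by move: tj; rewrite {1}/t ler_pdivrMr // [leRHS]mulrC.
pose n' := (n * (2 ^ j + 1))%N.
have n'n : (n <= n')%N by rewrite leq_pmulr // addn1.
exists (fun k => 2 ^+ j / n%:R * (weighted R m (n' * 2 ^ (k - j)) / 8 ^+ (k - j) / 8 ^+ j
                                  - weighted R m (n * 2 ^ k) / 8 ^+ k)).
  apply: is_cvgM; first exact: is_cvg_cst.
  apply: is_cvgB; last exact: cW.
  apply: is_cvgM; last exact: is_cvg_cst.
  have /cvg_ex[l cl] : cvgn (fun k => weighted R m (n' * 2 ^ k) / 8 ^+ k).
    exact: (cW n' (leq_trans Mn n'n) (leq_trans n0 n'n)).
  by apply/cvg_ex; exists l; rewrite (cvg_centern j (fun k => weighted R m (n' * 2 ^ k) / 8 ^+ k)).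
near=> k.
have jk : (j <= k)%N by near: k; exact: nbhs_infty_ge.
pose i := (k - j)%N; have kE : k = (i + j)%N by rewrite /i subnK.
rewrite -/i kE.
pose a := (n * 2 ^ i)%N; pose N := (n * 2 ^ (i + j))%N.
have N'E : (n' * 2 ^ i = N + a)%N by rewrite /n' /N /a expnD; lia.
have := weighted_bounds N a; rewrite -N'E -/N.
set D := weighted R m (n' * 2 ^ i); set D0 := weighted R m N => DD.
have n1 : 0 < n%:R :> R by rewrite ltr0n.
have p2 l : 0 < 2 ^+ l :> R by rewrite exprn_gt0.
have e8 l : 8 ^+ l = 2 ^+ l ^+ 3 :> R by rewrite -exprM mulnC exprM; congr (_ ^+ _); rewrite -natrX.
have e4 l : 4 ^+ l = 2 ^+ l ^+ 2 :> R by rewrite -exprM mulnC exprM; congr (_ ^+ _); rewrite -natrX.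
rewrite !e8 !e4 !exprD.
have NE : N%:R = n%:R * (2 ^+ i * 2 ^+ j) :> R by rewrite /N natrM natrX exprD.
have aE : a%:R = n%:R * 2 ^+ i :> R by rewrite /a natrM natrX.
set x := 2 ^+ i in NE aE *; set y := 2 ^+ j in jP NE aE *.
have x0 : 0 < x by exact: p2. have y0 : 0 < y by exact: p2.
have y1 : 1 <= y by rewrite /y -natrX ler1n expn_gt0.
have -> : y / n%:R * (D / x ^+ 3 / y ^+ 3 - D0 / (x * y) ^+ 3)
   = (D - D0) / (a%:R * (x * y) ^+ 2).
  by rewrite aE ramp_scaling // lt0r_neq0.
set P := (total m N)%:R.
have /andP[h1 h2] : a%:R * P <= D - D0 <= a%:R * P + a%:R ^+ 2 * (N%:R + a%:R).
  by move: DD; rewrite N'E natrD (natrM _ _ (total m N)) (natrM _ _ (N + a)) natrX (natrD _ N).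
have a0 : 0 < a%:R :> R by rewrite aE mulr_gt0.
have xy0 : 0 < (x * y) ^+ 2 by rewrite exprn_gt0 // mulr_gt0.
have -> : P / (x * y) ^+ 2 - (D - D0) / (a%:R * (x * y) ^+ 2)
   = - ((D - D0 - a%:R * P) / (a%:R * (x * y) ^+ 2)).
  rewrite [(_ - a%:R * P) / _]mulrBl opprB; congr (_ - _).
  by rewrite [(a%:R * (x * y) ^+ 2)^-1]invfM mulrACA divff ?mul1r // lt0r_neq0.
rewrite normrN ger0_norm; last by apply: divr_ge0; [rewrite subr_ge0 | apply: mulr_ge0; exact: ltW].
apply: le_trans jP; rewrite ler_pdivrMr ?mulr_gt0 //.
apply: (@le_trans _ _ (a%:R ^+ 2 * (N%:R + a%:R))); first lra.
rewrite NE aE.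
have -> : 2 * n%:R ^+ 2 / y * (n%:R * x * (x * y) ^+ 2) = (n%:R ^+ 3 * x ^+ 3) * (2 * y).
  have E : y^-1 * y ^+ 2 = y by rewrite expr2 mulKf // lt0r_neq0.
  transitivity (2 * n%:R ^+ 3 * x ^+ 3 * (y^-1 * y ^+ 2)); first lra.
  by rewrite E; lra.
have -> : (n%:R * x) ^+ 2 * (n%:R * (x * y) + n%:R * x) = (n%:R ^+ 3 * x ^+ 3) * (y + 1) by lra.
apply: ler_wpM2l; last lra.
by apply: mulr_ge0; apply: exprn_ge0; exact: ltW.
Unshelve. all: by end_near. Qed.
End Sandwich.
End Limits.

Lemma settledW M N f : (N <= M)%N -> settled N f -> settled M f.
Proof.
move=> NM [a b c d e g]; split=> //.
- by move=> x y z h; apply: c; lia.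
- by move=> s Ms; apply: d; lia.
- by move=> s x Ms; apply: e; lia.
- by move=> s x y Ms; apply: g; lia.
Qed.

Section Convergence.
Variable R : realType.

Lemma pow8 k : 8 ^+ k = 2 ^+ k ^+ 3 :> R.
Proof. by rewrite -exprM mulnC exprM; congr (_ ^+ _); rewrite -natrX. Qed.

Lemma pow4 k : 4 ^+ k = 2 ^+ k ^+ 2 :> R.
Proof. by rewrite -exprM mulnC exprM; congr (_ ^+ _); rewrite -natrX. Qed.

Lemma sum_half_le K : \sum_(0 <= k < K) (2 ^+ k)^-1 <= 2 :> R.
Proof.
suff -> : \sum_(0 <= k < K) (2 ^+ k)^-1 = 2 - 2 / 2 ^+ K :> R.
  by rewrite gerDl oppr_le0 divr_ge0 // exprn_ge0.
elim: K => [|K IH]; first by rewrite big_geq // expr0; lra.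
by rewrite big_nat_recr //= IH exprS invfM; lra.
Qed.

(** Let [b k] be the accumulated delays at [n 2^(k+1)] divided by [8^k].  Up to the
    factor [1/8] inherited from [b k], the term [b k.+1] is a block of the
    convergent series of [delays_summable], so the [b k] are summable; by
    [weighted_doubling] they bound the variation. *)
Lemma weighted_cvg M f : settled M f -> (0 < M)%N ->
  (forall T, (M <= T)%N -> (0 < tops f T T)%N) ->
  forall n, (M <= n)%N -> (0 < n)%N -> cvgn (fun k => weighted R (tally f) (n * 2 ^ k) / 8 ^+ k).
Proof.
move=> H M0 mpos n Mn n0.
have p2 l : 0 < 2 ^+ l :> R by rewrite exprn_gt0.
pose Q X : R := \sum_(M <= T < X) (delays f T)%:R / (16 * T%:R ^+ 3).
pose I X : R := \sum_(M <= T < X) (delays f T)%:R.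
have QB X : Q X <= energy R f M + 2 by exact: (delays_summable R H (leqnn M) M0 mpos).
set B0 := energy R f M + 2 in QB.
pose b k : R := I (n * 2 ^ k.+1)%N / 8 ^+ k.
have I0 X : 0 <= I X by apply: sumr_ge0.
have b0 k : 0 <= b k by rewrite /b pow8 divr_ge0 // exprn_ge0 // ltW.
have big k : (M <= n * 2 ^ k)%N.
  by apply: leq_trans Mn _; rewrite leq_pmulr // expn_gt0.
have grow k : (n * 2 ^ k <= n * 2 ^ k.+1)%N by rewrite leq_mul2l leq_exp2l ?leqnSn ?orbT.
have bS k : b k.+1 - b k / 8 <= 128 * n%:R ^+ 3 * (Q (n * 2 ^ k.+2)%N - Q (n * 2 ^ k.+1)%N).
  have split (F : nat -> R) : \sum_(M <= T < n * 2 ^ k.+2) F T =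
     \sum_(M <= T < n * 2 ^ k.+1) F T + \sum_(n * 2 ^ k.+1 <= T < n * 2 ^ k.+2) F T.
    by rewrite (@big_cat_nat _ _ _ (n * 2 ^ k.+1)).
  have -> : Q (n * 2 ^ k.+2)%N - Q (n * 2 ^ k.+1)%N =
      \sum_(n * 2 ^ k.+1 <= T < n * 2 ^ k.+2) (delays f T)%:R / (16 * T%:R ^+ 3).
    by rewrite /Q split addrC addKr.
  rewrite /b /I split exprS.
  set S := \sum_(M <= T < _) _; set S' := \sum_(n * 2 ^ k.+1 <= T < _) _.
  have -> : (S + S') / (8 * 8 ^+ k) - S / 8 ^+ k / 8 = S' / (8 * 8 ^+ k).
    by rewrite invfM; lra.
  rewrite mulr_sumr /S' mulr_suml big_nat [leRHS]big_nat; apply: ler_sum => T hT.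
  have T0 : 0 < T%:R :> R.
    by rewrite ltr0n; apply: leq_trans (_ : (n * 2 ^ k.+1 <= T)%N); [rewrite muln_gt0 n0 expn_gt0|lia].
  have TX : T%:R ^+ 3 <= (n * 2 ^ k.+2)%N%:R ^+ 3 :> R.
    by rewrite lerXn2r ?nnegrE // ler_nat; lia.
  have nE : (n * 2 ^ k.+2)%N%:R = n%:R * (4 * 2 ^+ k) :> R by rewrite natrM natrX !exprS; lra.
  rewrite nE in TX.
  have x0 := p2 k; rewrite pow8; set x := 2 ^+ k in x0 TX *.
  rewrite -subr_ge0.
  have -> : 128 * n%:R ^+ 3 * ((delays f T)%:R / (16 * T%:R ^+ 3)) - (delays f T)%:R / (8 * x ^+ 3)
     = (delays f T)%:R * ((64 * n%:R ^+ 3 * x ^+ 3 - T%:R ^+ 3) / (8 * x ^+ 3 * T%:R ^+ 3)).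
    have xT : x ^+ 3 / x ^+ 3 = 1 by rewrite divff // expf_neq0 // lt0r_neq0.
    have TT : T%:R ^+ 3 / T%:R ^+ 3 = 1 :> R by rewrite divff // expf_neq0 // lt0r_neq0.
    rewrite !invfM.
    transitivity (8 * n%:R ^+ 3 * (delays f T)%:R / T%:R ^+ 3 * (x ^+ 3 / x ^+ 3)
      - (delays f T)%:R / 8 / x ^+ 3 * (T%:R ^+ 3 / T%:R ^+ 3)); last lra.
    by rewrite xT TT; lra.
  apply: mulr_ge0 => //; apply: divr_ge0.
    rewrite subr_ge0; apply: le_trans TX _; rewrite le_eqVlt; apply/orP; left; apply/eqP; lra.
  by rewrite !mulr_ge0 // ?exprn_ge0 // ltW.
have sb K : 7 / 8 * \sum_(0 <= k < K) b k + b K <= b 0%N + 128 * n%:R ^+ 3 * Q (n * 2 ^ K.+1)%N.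
  elim: K => [|K IH].
    rewrite big_geq // mulr0 add0r lerDl !mulr_ge0 ?exprn_ge0 //.
    by apply: sumr_ge0 => T _; rewrite divr_ge0 ?mulr_ge0 ?exprn_ge0.
  by rewrite big_nat_recr //=; have := bS K; lra.
pose C0 : R := (16 * M ^ 2 + 6)%N%:R.
apply: (@cvg_bounded_variation R _
   (C0 * n%:R ^+ 2 * 2 / 8 + 5 / 7 * (b 0%N + 128 * n%:R ^+ 3 * B0))) => K.
apply: (@le_trans _ _ (\sum_(0 <= k < K) (C0 * n%:R ^+ 2 / 8 * (2 ^+ k)^-1 + 5 / 8 * b k))).
  apply: ler_sum => k _.
  have := @weighted_doubling R M f (n * 2 ^ k) H; rewrite M0 big => /(_ isT).
  have E : ((n * 2 ^ k).*2 = n * 2 ^ k.+1)%N by rewrite expnS; lia.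
  rewrite E -/C0 -/(I _) => h.
  have k8 : 0 < 8 ^+ k.+1 :> R by rewrite exprn_gt0.
  have -> : weighted R (tally f) (n * 2 ^ k.+1) / 8 ^+ k.+1 - weighted R (tally f) (n * 2 ^ k) / 8 ^+ k =
    (weighted R (tally f) (n * 2 ^ k.+1) - 8 * weighted R (tally f) (n * 2 ^ k)) / 8 ^+ k.+1.
    by rewrite exprS invfM; lra.
  rewrite normrM normfV (gtr0_norm k8) ler_pdivrMr //; apply: le_trans h _.
  rewrite /b natrX natrM natrX !pow8 (exprS 2 k); have x0 := p2 k; set x := 2 ^+ k in x0 *.
  rewrite le_eqVlt; apply/orP; left; apply/eqP.
  set J := I _.
  transitivity (C0 * n%:R ^+ 2 * (x^-1 * (x * x ^+ 2)) + 5 * J * ((x ^+ 3)^-1 * x ^+ 3)).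
    by rewrite mulKf ?mulVf ?expf_neq0 ?lt0r_neq0 //; lra.
  by clear; set x1 := x^-1; set x3 := (x ^+ 3)^-1; lra.
rewrite big_split /= -!mulr_sumr.
have h1 := sb K; have h2 := QB (n * 2 ^ K.+1)%N; have h3 := b0 K.
have c0 : 0 <= C0 * n%:R ^+ 2 / 8 by rewrite !mulr_ge0 // ?exprn_ge0.
have h4 := ler_wpM2l c0 (sum_half_le K).
have n3 : 0 <= 128 * n%:R ^+ 3 :> R by rewrite mulr_ge0 ?exprn_ge0.
have h5 := ler_wpM2l n3 h2; lra.
Qed.

Lemma total_cvg_of_doubling (m : nat -> nat) (M C : nat) :
  (forall N, (M <= N)%N -> (total m N.*2 <= 4 * total m N + C * N)%N /\
                           (4 * total m N <= total m N.*2 + C * N)%N) ->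
  forall n, (M <= n)%N -> (0 < n)%N -> cvgn (fun k => (total m (n * 2 ^ k))%:R / 4 ^+ k : R).
Proof.
move=> dbl n Mn n0.
apply: (@cvg_bounded_variation R _ (C%:R * n%:R / 4 * 2)) => K.
have c0 : 0 <= C%:R * n%:R / 4 :> R by rewrite !mulr_ge0.
apply: le_trans (ler_wpM2l c0 (sum_half_le K)); rewrite mulr_sumr; apply: ler_sum => k _.
have big : (M <= n * 2 ^ k)%N by apply: leq_trans Mn _; rewrite leq_pmulr // expn_gt0.
have E : ((n * 2 ^ k).*2 = n * 2 ^ k.+1)%N by rewrite expnS; lia.
have [] := dbl _ big; rewrite E.
set t1 := total m (n * 2 ^ k.+1); set t := total m (n * 2 ^ k).
rewrite -!(ler_nat R) !natrD !natrM natrX => h1 h2.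
have k4 : 0 < 4 ^+ k.+1 :> R by rewrite exprn_gt0.
have -> : t1%:R / 4 ^+ k.+1 - t%:R / 4 ^+ k = (t1%:R - 4 * t%:R) / 4 ^+ k.+1 :> R.
  by rewrite exprS invfM; lra.
rewrite normrM normfV (gtr0_norm k4) ler_pdivrMr //.
have x0 : 0 < 2 ^+ k :> R by rewrite exprn_gt0.
have -> : C%:R * n%:R / 4 / 2 ^+ k * 4 ^+ k.+1 = C%:R * (n%:R * 2 ^+ k) :> R.
  rewrite exprS pow4; set x := 2 ^+ k in x0 *.
  transitivity (C%:R * n%:R * (x^-1 * (x * x))); first lra.
  by rewrite mulKf ?mulrA // lt0r_neq0.
by rewrite ler_norml; lra.
Qed.
End Convergence.

(** * Closed squares and Nim addition *)

Local Open Scope nat_scope.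

Fixpoint nim_rec n x y :=
  if n is n'.+1 then (odd x (+) odd y) + (nim_rec n' x./2 y./2).*2 else 0.
(** Binary addition without carries; [x + y] digits suffice. *)
Definition nimadd x y := nim_rec (x + y) x y.

Lemma nim_rec_stable k n x y : x + y <= n -> nim_rec (n + k) x y = nim_rec n x y.
Proof.
elim: n x y => [|n IH] x y xy.
  have [-> ->] : x = 0 /\ y = 0 by lia.
  by elim: k => //= k; rewrite !add0n => ->.
by rewrite addSn /= IH //; lia.
Qed.

Lemma nimaddE x y : nimadd x y = (odd x (+) odd y) + (nimadd x./2 y./2).*2.
Proof.
rewrite /nimadd -(nim_rec_stable 1 (leqnn _)) addn1 /=; congr (_ + _.*2).
have -> : x + y = x./2 + y./2 + (uphalf x + uphalf y) by lia.
exact: nim_rec_stable.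
Qed.

Lemma odd_nimadd x y : odd (nimadd x y) = odd x (+) odd y.
Proof. by rewrite nimaddE oddD odd_double addbF oddb. Qed.

Lemma half_nimadd x y : (nimadd x y)./2 = nimadd x./2 y./2.
Proof. by rewrite {1}nimaddE half_bit_double. Qed.

Lemma eq_odd_half a b : odd a = odd b -> a./2 = b./2 -> a = b.
Proof. by move=> o h; rewrite -(odd_double_half a) o h odd_double_half. Qed.

Lemma nimaddC x y : nimadd x y = nimadd y x.
Proof.
elim/ltn_ind: x y => x IH y; apply: eq_odd_half; rewrite ?odd_nimadd 1?addbC // !half_nimadd.
case: x IH => [_|x IH]; last by apply: IH; lia.
rewrite /=; elim/ltn_ind: y => y IH2; case: (posnP y) => [->//|y0].
by apply: eq_odd_half; rewrite ?odd_nimadd 1?addbC // !half_nimadd; apply: IH2; lia.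
Qed.

Lemma nim0add y : nimadd 0 y = y.
Proof.
elim/ltn_ind: y => y IH; case: (posnP y) => [->//|y0].
by apply: eq_odd_half; rewrite ?odd_nimadd // half_nimadd /= IH //; lia.
Qed.

Lemma nimaddK x y : nimadd x (nimadd x y) = y.
Proof.
elim/ltn_ind: x y => x IH y; case: (posnP x) => [->|x0]; first by rewrite !nim0add.
by apply: eq_odd_half; rewrite ?odd_nimadd ?addKb // !half_nimadd IH //; lia.
Qed.

Lemma nimadd_mex x y z : z < nimadd x y -> nimadd x z < y \/ nimadd z y < x.
Proof.
have [n] := ubnP (x + y); elim: n x y z => // n IH x y z xy zl.
case: (posnP (x + y)) => [xy0|xy0].
  by move: zl; have [-> ->] : x = 0 /\ y = 0 by lia.
have lt_half a b : a./2 < b./2 -> a < b by lia.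
case: (ltngtP z./2 (nimadd x./2 y./2)) => [h|h|h].
- have [] := IH _ _ _ _ h; first lia.
    by move=> ?; left; apply: lt_half; rewrite half_nimadd.
  by move=> ?; right; apply: lt_half; rewrite half_nimadd.
- by move: (half_nimadd x y) h zl; lia.
- have lt_odd a b : a./2 = b./2 -> odd a = false -> odd b -> a < b by lia.
  have [ez oxy] : odd z = false /\ odd x (+) odd y.
    have hh := half_nimadd x y; have := odd_nimadd x y; rewrite -h in hh.
    by case: (odd x (+) odd y) => oo; split=> //; lia.
  case oy : (odd y); [left|right]; apply: lt_odd => //.
  + by rewrite half_nimadd h nimaddK.
  + by rewrite odd_nimadd ez addbF; move: oxy; rewrite oy; case: (odd x).
  + by rewrite half_nimadd h nimaddC [nimadd x./2 _]nimaddC nimaddK.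
  + by rewrite odd_nimadd ez oy.
  + by move: oxy; rewrite oy addbF.
Qed.

Lemma nimadd_lt J a b : a < 2 ^ J -> b < 2 ^ J -> nimadd a b < 2 ^ J.
Proof.
elim: J a b => [|J IH] a b; first by rewrite !ltnS !leqn0 => /eqP-> /eqP->.
rewrite expnS => aJ bJ; have := IH a./2 b./2 ltac:(lia) ltac:(lia).
by have := half_nimadd a b; lia.
Qed.

Lemma nimadd_top J a b : 2 ^ J <= a < 2 ^ J.+1 -> 2 ^ J <= b < 2 ^ J.+1 -> nimadd a b < 2 ^ J.
Proof.
elim: J a b => [|J IH] a b.
  by move=> a1 b1; have [-> ->] : a = 1 /\ b = 1 by lia.
rewrite !(expnS 2 J.+1) (expnS 2 J) => aJ bJ.
have := IH a./2 b./2; rewrite (expnS 2 J) => /(_ ltac:(lia) ltac:(lia)).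
by have := half_nimadd a b; lia.
Qed.

(** As [h > 2^(J-1)], the initial segment [[0, p)] is stable under flipping each of
    the lowest [J] binary digits. *)
Lemma nimadd_closed_dvd J h p : 2 ^ J < h.*2 ->
  (forall x y, x < h -> y < p -> nimadd x y < p) -> 2 ^ J %| p.
Proof.
elim: J h p => [|J IH] h p; first by rewrite dvd1n.
rewrite expnS => hJ cl.
have J0 : 0 < 2 ^ J by rewrite expn_gt0.
have pe : odd p = false.
  apply/negbTE/negP => op; have p0 : 0 < p by case: p op {cl}.
  have := cl 1 p.-1 ltac:(lia) ltac:(lia).
  have := half_nimadd 1 p.-1; have := odd_nimadd 1 p.-1; rewrite nim0add /=; lia.
have -> : p = 2 * p./2 by lia.
rewrite dvdn_pmul2l //; apply: (IH (uphalf h)); first lia.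
move=> x y xh yp; have := cl x.*2 y.*2 ltac:(lia) ltac:(lia).
by have := half_nimadd x.*2 y.*2; rewrite !doubleK; lia.
Qed.

Definition closed_below (f : nat -> nat -> nat) h := forall x y, x < h -> y < h -> f x y < h.

Section ClosedSquares.
Variables (N : nat) (f : nat -> nat -> nat).
Hypothesis H : settled N f.
Let fC := tableC H.
Let fK := tableK H.

(** If [x] and [y] below [T] had [f x y >= T], then [{x, y, T}] or, by the rule,
    some other [{x, u, T}] or [{u, y, T}] would be counted by [tops f T T]. *)
Lemma closed_belowP T : N <= T -> tops f T T = 0 <-> closed_below f T.
Proof.
move=> NT; split; last first.
  move=> cl; rewrite /tops big_nat big1 // => t tT.
  case: ltnP => // h; have := cl t (f t T) ltac:(lia) ltac:(lia); rewrite fK; lia.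
move=> l0.
have no t : t < T -> t <= f t T.
  move=> tT; rewrite leqNgt; apply/negP => ft.
  move: l0; rewrite /tops (@big_cat_nat _ _ _ t) //=; last lia.
  by rewrite (@big_ltn _ _ _ t) // ft; lia.
suff cl x y : x < y -> y < T -> f x y < T.
  move=> x y xT yT; case: (ltngtP x y) => [xy|xy|->]; [exact: cl|by rewrite fC; exact: cl|].
  by rewrite ltnNge; apply/negP => h; apply: (@table_diag _ _ H (f y y) y); lia.
move=> xy yT; rewrite ltnNge; apply/negP => h.
have nd t : f t T <> t.
  by move=> E; apply: (@table_diag _ _ H T t NT); rewrite -{2}E fK.
have ki z : f (f z T) T = z by rewrite fC [f z T]fC fK.
move: h; rewrite leq_eqVlt => /orP[/eqP E|lt].
  have fy : f y T = x by rewrite E [f x y]fC fK.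
  by have := no y yT; lia.
have := table_mex H (x := x) (y := y) (z := T); rewrite NT !orbT => /(_ isT lt) [v|v].
  have := no x; have := no (f x T); rewrite ki; have := nd x; lia.
by rewrite fC in v; have := no y; lia.
Qed.

Section Row.
Variable h : nat.
Hypotheses (Nh : N <= h) (cl : closed_below f h).

Lemma closed_ge x y : x < h -> h <= y -> h <= f x y.
Proof.
move=> xh hy; rewrite leqNgt; apply/negP => l.
by have := cl xh l; rewrite fK; lia.
Qed.

(** A row [x < h] sends columns beyond [h] beyond [h], so after translation by
    [h] it obeys the recursion that defines Nim addition. *)
Lemma closed_row x y : x < h -> f x (h + y) = h + nimadd x y.
Proof.
have [n] := ubnP (x + y); elim: n x y => // n IH x y xyn xh.
have := closed_ge xh (leq_addr y h).
have inj u v w : f u w = f v w -> u = v.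
  by rewrite !(fC _ w) => E; rewrite -(fK w u) E fK.
have injn u v w : nimadd u w = nimadd v w -> u = v.
  by rewrite !(nimaddC _ w) => E; rewrite -(nimaddK w u) E nimaddK.
move=> ha; have [a E] : exists a, f x (h + y) = h + a by exists (f x (h + y) - h); lia.
rewrite E; congr (_ + _); case: (ltngtP a (nimadd x y)) => // lt.
- have [l|l] := nimadd_mex lt.
    have := IH x (nimadd x a) ltac:(lia) xh; rewrite nimaddK -E => E2.
    have := fK x (h + y); rewrite -E2 fK; lia.
  have := IH (nimadd a y) y ltac:(lia) ltac:(lia).
  rewrite [nimadd a y]nimaddC [nimadd (nimadd y a) y]nimaddC nimaddK -E => /inj; rewrite nimaddC; lia.
- have := table_mex H (x := x) (y := h + y) (z := h + nimadd x y).
  rewrite (_ : [|| _, _ | _]) ?E; last lia.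
  move=> /(_ isT ltac:(lia)) [l|l].
    have g := closed_ge xh (leq_addr (nimadd x y) h).
    have [v Ev] : exists v, f x (h + nimadd x y) = h + v.
      by exists (f x (h + nimadd x y) - h); lia.
    have := IH x v ltac:(lia) xh; rewrite -Ev fK => /addnI.
    by rewrite !(nimaddC x) => /injn; lia.
  have := IH (f (h + nimadd x y) (h + y)) y ltac:(lia) ltac:(lia).
  by rewrite fC [f (h + nimadd x y) _]fC fK => /addnI /injn; rewrite fC; lia.
Qed.

(** By [closed_row] the segment of length [h' - h] is stable under Nim addition
    of all [x < h], so [2^J] divides [h' - h], and the bound [h' < 3h] leaves
    [h' - h = 2^J].  If [h < 2^J], the entry at [(h, 2h)] has no possible
    value. *)
Lemma next_closed_pow2 J h' : h < h' -> h' < 3 * h -> closed_below f h' ->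
  h <= 2 ^ J < h.*2 -> h = 2 ^ J.
Proof.
move=> hh' h3 cl' hJ.
have dv : 2 ^ J %| h' - h.
  apply: (@nimadd_closed_dvd _ h); first lia.
  move=> x y xh yp; have := cl' x (h + y) ltac:(lia) ltac:(lia).
  by rewrite closed_row //; lia.
have p : h' - h = 2 ^ J by case/dvdnP: dv => -[|[|k]] E; nia.
apply/eqP; rewrite eqn_leq (andP hJ).1 leqNgt /=; apply/negP => lt.
have [J1 EJ] : exists J1, J = J1.+1.
  by case: J hJ lt {dv p} => [|J1]; [rewrite expn0; lia | exists J1].
(* [v < h] and [v = h + v'] with [v' < h] both contradict [closed_row]; so
   [h <= v' < 2^J], and [nimadd h v' < h] gives a last contradiction. *)
set v := f h (h + h).
have vl : v < h' by apply: cl'; lia.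
have E2 : f (h + h) v = h by rewrite fC /v fC [f h _]fC fK.
have Ehv : f h v = h + h by exact: fK.
have vh : h <= v.
  rewrite leqNgt; apply/negP => vs; have := closed_row 0 vs.
  by rewrite addn0 nimaddC nim0add fC Ehv; lia.
have [v' Ev] : exists v', v = h + v' by exists (v - h); lia.
have v'h : h <= v'.
  rewrite leqNgt; apply/negP => vs; have := closed_row 0 vs.
  rewrite addn0 nimaddC nim0add -Ev fC => E3.
  by have := fK h v'; rewrite E3 Ehv; lia.
have x1 : nimadd h v' < 2 ^ J1.
  by apply: nimadd_top; move: hJ lt; rewrite -?EJ EJ expnS; move: p; rewrite EJ expnS; lia.
have x2 : nimadd h v' < h by move: hJ; rewrite EJ expnS; lia.
have := closed_row h x2; rewrite [nimadd (nimadd h v') h]nimaddC nimaddK -Ev => E3.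
have : f (h + h) (f (nimadd h v') (h + h)) = nimadd h v' by rewrite [f (nimadd h v') _]fC fK.
by rewrite E3; lia.
Qed.
End Row.

(** The square [[0, 2^J)^2] is closed both under [f] and under Nim addition, so the
    excluded-value recursion outside it is the same for both tables. *)
Lemma nim_beyond J : N <= 2 ^ J -> closed_below f (2 ^ J) ->
  forall x y, 2 ^ J <= maxn x y -> f x y = nimadd x y.
Proof.
set q := 2 ^ J => Nq cl x y.
have clf u v w : f u v = w -> u < q -> w < q -> v < q.
  by move=> <- uq wq; rewrite -(fK u v); exact: cl.
have cln u v w : nimadd u v = w -> u < q -> w < q -> v < q.
  by move=> <- uq wq; rewrite -(nimaddK u v); exact: nimadd_lt.
have [n] := ubnP (x + y); elim: n x y => // n IH x y xyn mx.
have nlt u v : u < q -> v < q -> nimadd u v < q by exact: nimadd_lt.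
have NX : [|| N <= x, N <= y | N <= nimadd x y] by lia.
have fyx u v : f (f u v) v = u by rewrite fC [f u v]fC fK.
have nyx u v : nimadd (nimadd u v) v = u by rewrite nimaddC [nimadd u v]nimaddC nimaddK.
case: (ltngtP (f x y) (nimadd x y)) => // lt.
- set a := f x y in lt *; have Ea : f x a = y by exact: fK.
  have [l|l] := nimadd_mex lt.
    case: (leqP q (maxn x (nimadd x a))) => c.
      have := IH x (nimadd x a) ltac:(lia) c; rewrite nimaddK => E.
      by have := fK x (nimadd x a); rewrite E Ea; lia.
    have aq : a < q by rewrite -(nimaddK x a); apply: nlt; lia.
    by have := clf _ _ _ (erefl a) ltac:(lia) aq; lia.
  case: (leqP q (maxn (nimadd a y) y)) => c.
    have := IH (nimadd a y) y ltac:(lia) c; rewrite nyx => E.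
    by have := fyx x y; have := fyx (nimadd a y) y; rewrite E -/a; lia.
  have aq : a < q by rewrite -(nyx a y); apply: nlt; lia.
  by have := clf y x a (fC y x) ltac:(lia) aq; lia.
- set b := nimadd x y in lt NX *; have Eb : nimadd x b = y by exact: nimaddK.
  have [l|l] := table_mex H NX lt.
    case: (leqP q (maxn x (f x b))) => c.
      have := IH x (f x b) ltac:(lia) c; rewrite fK => E.
      by have := nimaddK x (f x b); rewrite -E Eb; lia.
    have bq : b < q by rewrite -(fK x b); apply: cl; lia.
    by have := cln _ _ _ (erefl b) ltac:(lia) bq; lia.
  case: (leqP q (maxn (f b y) y)) => c.
    have := IH (f b y) y ltac:(lia) c; rewrite fyx => E.
    by have := nyx x y; have := nyx (f b y) y; rewrite -E -/b; lia.
  have bq : b < q by rewrite -(fyx b y); apply: cl; lia.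
  by have := cln y x b (nimaddC y x) ltac:(lia) bq; lia.
Qed.
End ClosedSquares.

(** Pair [h + i] with [3h - 1 - i]: the harmonic weights of a pair sum to more
    than [1 / h]. *)
Lemma sum_next_pot (R : realFieldType) h : 0 < h ->
  (1 < \sum_(h <= j < 3 * h) pot R j)%R.
Proof.
move=> h0; rewrite (@big_cat_nat _ _ _ (2 * h)) /=; [|lia|lia].
have -> : (\sum_(h <= j < 2 * h) pot R j = \sum_(0 <= i < h) pot R (h + i))%R.
  rewrite -{1}[h]add0n big_addn (_ : 2 * h - h = h); last lia.
  by apply: eq_bigr => i _; rewrite addnC.
have -> : (\sum_(2 * h <= j < 3 * h) pot R j = \sum_(0 <= i < h) pot R (3 * h - i.+1))%R.
  rewrite big_nat_rev /= -{1}[2 * h]add0n big_addn (_ : 3 * h - 2 * h = h); last lia.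
  by apply: eq_bigr => i _; congr pot; lia.
rewrite -big_split /=.
have -> : (1 = \sum_(0 <= i < h) (h%:R^-1 : R))%R.
  by rewrite sumr_const_nat subn0 -[RHS]mulr_natr mulVf // pnatr_eq0; lia.
apply: ltr_sum_nat => // i ih.
have -> : (pot R (h + i) = (h + i)%:R^-1)%R by case: h h0 {ih}.
have [k Ek] : exists k, 3 * h - i.+1 = k.+1 by exists (3 * h - i.+1).-1; lia.
have -> : (pot R (3 * h - i.+1) = (3 * h - i.+1)%:R^-1)%R by rewrite Ek.
have E : ((3 * h - i.+1)%:R = 3 * h%:R - i%:R - 1 :> R)%R by rewrite natrB ?natrM -?natr1; [lra | lia].
rewrite E natrD.
have hR : (1 <= h%:R :> R)%R by rewrite ler1n.
have iR : (0 <= i%:R :> R)%R by [].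
have ihR : (i%:R + 1 <= h%:R :> R)%R by rewrite natr1 ler_nat; lia.
set x := (h%:R)%R in hR ihR *; set y := (i%:R)%R in iR ihR *.
rewrite -subr_gt0.
have -> : ((x + y)^-1 + (3 * x - y - 1)^-1 - x^-1 =
   ((x - y) ^+ 2 + y) / (x * (x + y) * (3 * x - y - 1)))%R.
  rewrite -[((x + y)^-1)%R]div1r -[((3 * x - y - 1)^-1)%R]div1r -[(x^-1)%R]div1r -!mulNr.
  rewrite !addf_div ?mulf_neq0 ?lt0r_neq0 //; lra.
have xy : (0 < (x - y) ^+ 2)%R by rewrite exprn_gt0 //; lra.
by rewrite divr_gt0 ?mulr_gt0 //; lra.
Qed.

Lemma nat_sum_even_odd (phi : nat -> nat) n :
  \sum_(0 <= i < n.*2) phi i = \sum_(0 <= i < n) (phi i.*2 + phi i.*2.+1).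
Proof.
elim: n => [|n IH]; first by rewrite !big_geq.
by rewrite doubleS !big_nat_recr //= IH addnA.
Qed.

(** As [T > 0], the last binary digits never decide the comparison of
    [nimadd t s] with [t].  The odd case has the additional row [t = 2T], for
    which [nimadd t (2T+1) = 1]. *)
Lemma nim_tops_double T : 0 < T ->
  tops nimadd T.*2 T.*2 = 2 * tops nimadd T T /\
  tops nimadd T.*2.+1 T.*2.+1 = 2 * tops nimadd T T + 1.
Proof.
move=> T0.
have nx0 t : nimadd t 0 = t by rewrite nimaddC nim0add.
have nxx t : nimadd t t = 0 by have := nimaddK t 0; rewrite nx0.
have halfbit (c : bool) t : (c + t.*2)./2 = t by rewrite half_bit_double.
have oddbit (c : bool) t : odd (c + t.*2) = c by rewrite oddD odd_double addbF oddb.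
have lt (b c : bool) t : (nimadd (c + t.*2) (b + T.*2) < c + t.*2) = (nimadd t T < t).
  have := half_nimadd (c + t.*2) (b + T.*2); have := odd_nimadd (c + t.*2) (b + T.*2).
  rewrite !halfbit !oddbit => o hf.
  have nT : nimadd t T <> t.
    by move=> E; have := nimaddK t T; rewrite E nxx; lia.
  by move: nT o hf; case: b; case: c; lia.
have ev (b : bool) t : (nimadd t.*2 (b + T.*2) < t.*2) = (nimadd t T < t) by exact: (lt b false).
have od (b : bool) t : (nimadd t.*2.+1 (b + T.*2) < t.*2.+1) = (nimadd t T < t) by exact: (lt b true).
have main (b : bool) : \sum_(0 <= t < T.*2) (nimadd t (b + T.*2) < t) = 2 * tops nimadd T T.
  rewrite nat_sum_even_odd /tops big_distrr /=; apply: eq_bigr => t _.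
  by rewrite ev od; lia.
split; first exact: (main false).
rewrite /tops big_nat_recr //= (main true); congr (_ + _).
have := half_nimadd T.*2 T.*2.+1.
have -> : T.*2.+1./2 = T by lia.
have -> : nimadd T.*2./2 T = 0 by rewrite doubleK nxx.
lia.
Qed.

Section ClosedSquares.
Variables (N : nat) (f : nat -> nat -> nat).
Hypothesis H : settled N f.

(** At a closed square the charge vanishes and the energy is a harmonic sum;
    between consecutive ones it grows by at most [1], while the sum from [h] to
    [3h] exceeds [1]. *)
Lemma next_closed_lt h h' : 0 < h -> N <= h < h' -> tops f h h = 0 -> tops f h' h' = 0 ->
  (forall T, h < T < h' -> 0 < tops f T T) -> h' < 3 * h.
Proof.
move=> h0 hh lh lh' mid; rewrite ltnNge; apply/negP => h3.
have charge0 T : N <= T -> tops f T T = 0 -> charge f (slope rat) T = 0%R.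
  move=> NT /(closed_belowP H NT) cl; rewrite /charge big_nat big1 // => s sT.
  rewrite [tops f T s](_ : _ = 0) ?big_geq //.
  rewrite /tops big_nat big1 // => t tT; case: ltnP => // l.
  by have := cl t (f t s) ltac:(lia) ltac:(lia); rewrite (tableK H); lia.
have := @energy_gap rat N f H h h' hh h0 mid.
rewrite /energy !charge0 //; [|lia|lia].
rewrite (@big_cat_nat _ _ _ h 1 h') /=; [|lia|lia].
rewrite (@big_cat_nat _ _ _ (3 * h) h h') /=; [|lia|lia].
have := sum_next_pot rat h0.
have : (0 <= \sum_(3 * h <= j < h') pot rat j)%R.
  by apply: sumr_ge0 => j _; apply: ltW; exact: pot_gt0.
move: (\sum_(3 * h <= j < h') _)%R (\sum_(h <= j < 3 * h) _)%R (\sum_(1 <= j < h) _)%R.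
clear => s1 s2 s3; lra.
Qed.

Lemma closed_eventually_nim : (forall M, exists2 T, M <= T & tops f T T = 0) ->
  exists2 q, N <= q & forall x y, q <= maxn x y -> f x y = nimadd x y.
Proof.
move=> inf; have [h hM lh] := inf (maxn N 2).
have ex : exists T, (h < T) && (tops f T T == 0).
  by have [T hT /eqP lT] := inf h.+1; exists T; rewrite hT lT.
case: (ex_minnP ex) => h' /andP[hh' /eqP lh'] hmin.
have mid T : h < T < h' -> 0 < tops f T T.
  move=> hT; rewrite lt0n; apply/negP => l0.
  by have := hmin T; rewrite l0 (andP hT).1 /= => /(_ isT); lia.
have h3 := next_closed_lt _ _ lh lh' mid.
have {}h3 : h' < 3 * h by apply: h3; lia.
have up := up_log_bounds (isT : 1 < 2) (_ : 1 < h).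
have {}up : 2 ^ (up_log 2 h).-1 < h <= 2 ^ up_log 2 h by apply: up; lia.
have up0 : 0 < up_log 2 h by rewrite lt0n; apply/eqP => u0; move: up; rewrite u0; lia.
have hJ : h <= 2 ^ up_log 2 h < h.*2.
  have : 2 ^ up_log 2 h = 2 * 2 ^ (up_log 2 h).-1 by rewrite -expnS prednK.
  by lia.
have Nh : N <= h by lia.
have clh := (closed_belowP H Nh).1 lh.
have clh' : closed_below f h' by apply/(closed_belowP H) => //; lia.
have E := next_closed_pow2 H Nh clh hh' h3 clh' hJ.
exists h => // x y; rewrite E; apply: (nim_beyond H); rewrite -E //.
Qed.

(** Counts beyond the closed square double exactly by [nim_tops_double]; the
    finitely many others, and the summand [1] of the odd rows, are linear in
    [Y]. *)
Lemma closed_doubling : (forall M, exists2 T, M <= T & tops f T T = 0) ->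
  exists M C, forall Y, M <= Y ->
    total (tally f) Y.*2 <= 4 * total (tally f) Y + C * Y /\
    4 * total (tally f) Y <= total (tally f) Y.*2 + C * Y.
Proof.
move=> inf; have [q Nq nim] := closed_eventually_nim inf.
have lE T : q <= T -> tops f T T = tops nimadd T T.
  by move=> qT; rewrite /tops big_nat [RHS]big_nat; apply: eq_bigr => t tT; rewrite nim //; lia.
exists q.+1, (1 + 4 * q.+1 ^ 2) => Y qY.
rewrite /total /tally nat_sum_even_odd !(@big_cat_nat _ _ _ q.+1 0 Y) //=; try lia.
set A := \sum_(0 <= i < q.+1) _; set A' := \sum_(0 <= i < q.+1) _.
set B := \sum_(q.+1 <= i < Y) _; set B' := \sum_(q.+1 <= i < Y) _.
have EB : B = 4 * B' + (Y - q.+1).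
  rewrite -sum_nat1 /B' big_distrr -big_split /B big_nat [RHS]big_nat /=.
  apply: eq_bigr => T hT; rewrite !lE; try lia.
  by have [-> ->] := @nim_tops_double T ltac:(lia); lia.
have bd (F : nat -> nat) c : (forall T, T <= q -> F T <= c) -> \sum_(0 <= i < q.+1) F i <= q.+1 * c.
  move=> Fc; apply: (@leq_trans (\sum_(0 <= i < q.+1) c)); last by rewrite sum_nat_const_nat subn0.
  by rewrite big_nat [X in _ <= X]big_nat; apply: leq_sum => i hi; apply: Fc; lia.
have hA : A <= q.+1 * (4 * q.+1).
  by apply: bd => T hT; have := tops_le f T.*2 T.*2; have := tops_le f T.*2.+1 T.*2.+1; lia.
have hA' : A' <= q.+1 * q by apply: bd => T hT; have := tops_le f T T; lia.
by split; nia.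
Qed.
End ClosedSquares.

(** * Counting P-positions in a box *)

Definition distinct_total f Y := total (tally f) Y.

Section Count.
Variables (N : nat) (f : nat -> nat -> nat).
Hypothesis H : settled N f.

Lemma distinct_total_square Y :
  distinct_total f Y = \sum_(0 <= T < Y) \sum_(0 <= t < Y) ((t < T) && (f t T < t)).
Proof.
rewrite /distinct_total /total /tally big_nat [RHS]big_nat; apply: eq_bigr => T TY.
rewrite [RHS](@big_cat_nat _ _ _ T) //=; last lia.
rewrite [X in _ = _ + X]big_nat [X in _ = _ + X]big1 ?addn0; last by move=> t tT; lia.
by rewrite /tops big_nat [RHS]big_nat; apply: eq_bigr => t tT; lia.
Qed.

(** The form in which the count is compared with [nb_P_positions_sum]. *)
Lemma distinct_total_triples Y :
  distinct_total f Y = \sum_(0 <= t < Y) \sum_(0 <= u < Y) (u < t < f u t) && (f u t < Y).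
Proof.
rewrite distinct_total_square exchange_big_nat /= big_nat [RHS]big_nat; apply: eq_bigr => t tY.
transitivity (\sum_(0 <= T < Y) (((t < T) && (f t T < t)) && (0 <= f t T < Y) : nat)).
  by rewrite big_nat [RHS]big_nat; apply: eq_bigr => T TY; lia.
rewrite (@sum_transport (fun T u => (t < T) && (u < t)) (f t) (f t)); last first.
  by move=> u v; rewrite (table_eq H).
by apply: eq_bigr => u _; rewrite (tableC H u t); lia.
Qed.

Lemma sum_mids_le Y : \sum_(0 <= s < Y) mids f s <= distinct_total f Y.*2.
Proof.
rewrite distinct_total_square exchange_big_nat /= [X in _ <= X](@big_cat_nat _ _ _ Y) //=; last lia.
apply: leq_trans (leq_addr _ _); rewrite big_nat [X in _ <= X]big_nat; apply: leq_sum => s sY.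
rewrite [X in _ <= X](@big_cat_nat _ _ _ s.+1) //=; last lia.
apply: leq_trans (leq_addl _ _).
rewrite /mids (@big_nat_widen _ _ _ s.+1 s.*2 Y.*2) /=; last lia.
rewrite big_mkcond /= big_nat [X in _ <= X]big_nat; apply: leq_sum => u su.
by case: ifP => //; lia.
Qed.

Lemma distinct_total_mono Y Z : Y <= Z -> distinct_total f Y <= distinct_total f Z.
Proof.
move=> YZ; rewrite /distinct_total /total /tally.
by rewrite [X in _ <= X](@big_cat_nat _ _ _ Y) //= leq_addr.
Qed.

(** By [tops_mids] the sum of all [s < Y] is [2 m s + w s + 1] summed, and every
    P-position with middle heap below [Y] has its top below [2Y]. *)
Lemma distinct_total_lower Y : N.*2 + 6 <= Y -> Y ^ 2 <= 12 * distinct_total f Y.*2.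
Proof.
move=> NY.
have h1 : \sum_(N.+1 <= s < Y) s <= 3 * distinct_total f Y.*2 + Y.
  have -> : \sum_(N.+1 <= s < Y) s = \sum_(N.+1 <= s < Y) ((tops f s s).*2 + mids f s + 1).
    by rewrite big_nat [RHS]big_nat; apply: eq_bigr => s hs; apply: (tops_mids H); lia.
  rewrite !big_split /= sum_nat1.
  have part (G : nat -> nat) : \sum_(N.+1 <= s < Y) G s <= \sum_(0 <= s < Y) G s.
    by rewrite [X in _ <= X](@big_cat_nat _ _ _ N.+1) //= ?leq_addl //; lia.
  have := part (mids f); have := sum_mids_le Y.
  have : \sum_(N.+1 <= s < Y) (tops f s s).*2 <= 2 * distinct_total f Y.
    have -> : \sum_(N.+1 <= s < Y) (tops f s s).*2 = 2 * \sum_(N.+1 <= s < Y) tops f s s.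
      by rewrite big_distrr /=; apply: eq_bigr => s _; rewrite mul2n.
    by rewrite leq_mul2l /=; exact: part.
  have := @distinct_total_mono Y Y.*2 ltac:(lia); lia.
have h2 : forall Z, N.+1 <= Z -> Z * Z.-1 <= (\sum_(N.+1 <= s < Z) s).*2 + N.+1 * N.
  elim=> // Z IH; rewrite leq_eqVlt => /orP[/eqP [<-]|lt]; first by rewrite big_geq.
  by rewrite big_nat_recr //=; have := IH ltac:(lia); nia.
have := h2 Y ltac:(lia); nia.
Qed.
End Count.

Section Positions.
Variable F : {fset position}.
Let f := third F.
Local Open Scope fset_scope.

(** Each P-position is listed once, by its two smaller heaps [x <= y]. *)
Lemma nb_P_positions_sum Y : nb_P_positions F Y =
  \sum_(0 <= y < Y) \sum_(0 <= x < Y) ((x <= y <= f x y) && (f x y < Y)).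
Proof.
pose good (u : nat * nat) := (u.2 <= u.1 <= f u.2 u.1) && (f u.2 u.1 < Y).
pose pairs := [seq u <- [seq (y, x) | y <- iota 0 Y, x <- iota 0 Y] | good u].
pose at_pair (u : nat * nat) := pos u.2 u.1 (f u.2 u.1).
have upairs : uniq pairs.
  by rewrite filter_uniq // allpairs_uniq ?iota_uniq // => -[a b] [c d].
have pairsP u : u \in pairs = (good u && ((u.1 < Y) && (u.2 < Y))).
  rewrite mem_filter; congr (_ && _); case: u => y x; apply/allpairsP/idP => /=.
    by case=> -[y' x'] /= []; rewrite !mem_iota !add0n => ? ? [-> ->]; lia.
  by move=> h; exists (y, x); rewrite !mem_iota; split=> //=; lia.
have fin : finite_set (P_positions F `&` box Y) by exact: sub_finite_set (@subIsetr _ _ _) (finite_box Y).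
have mem A : (A \in fset_set (P_positions F `&` box Y)) = (A \in [seq at_pair u | u <- pairs]).
  rewrite in_fset_set //; apply/idP/mapP => [/set_mem [PA bA]|[u]].
    have [x [y [z [xyz EA]]]] := pos_sorted A; subst A.
    have Ez : f x y = z by apply/thirdP.
    have b v : [|| v == x, v == y | v == z] -> v < Y by rewrite -mem_pos => /bA.
    exists (y, x); last by rewrite /at_pair /= Ez.
    rewrite pairsP /good /= Ez xyz.
    by have := b x; have := b y; have := b z; rewrite !eqxx ?orbT /=; lia.
  rewrite pairsP => /andP[g uY] ->; apply/mem_set; split.
    by rewrite /at_pair; apply/thirdP.
  by move=> v; rewrite mem_pos; move: g; rewrite /good; lia.
rewrite /nb_P_positions; transitivity (size [seq at_pair u | u <- pairs]).
  apply/perm_size/uniq_perm; [exact: fset_uniq| |exact: mem].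
  rewrite map_inj_in_uniq // => -[y x] [y' x']; rewrite !pairsP /good /=.
  move=> /andP[/andP[g _] _] /andP[/andP[g' _] _] E.
  by have [-> -> _] := pos_inj g g' E.
rewrite size_map /pairs size_filter -sum1_count big_mkcond big_allpairs /=.
rewrite /index_iota subn0; apply: eq_bigr => y _; apply: eq_bigr => x _.
by rewrite /good /=; case: ifP.
Qed.

(** A P-position with a repeated heap is [{y, y, f y y}], and for a given [y]
    at most two values of [x <= y] produce one. *)
Lemma nb_P_positions_bounds M Y : settled M f ->
  distinct_total f Y <= nb_P_positions F Y <= distinct_total f Y + 2 * Y.
Proof.
move=> H; rewrite nb_P_positions_sum (distinct_total_triples H); apply/andP; split.
  by apply: leq_sum => y _; apply: leq_sum => x _; lia.
have -> : 2 * Y = \sum_(0 <= y < Y) 2 by rewrite sum_nat_const_nat subn0 mulnC.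
rewrite -big_split /=; apply: leq_sum => y _.
apply: (@leq_trans (\sum_(0 <= x < Y) ((x < y < f x y) && (f x y < Y) + (y == x) + (f y y == x)))).
  apply: leq_sum => x _; have : (f y y == x) = (f x y == y).
    by rewrite (table_eq H y y x) (tableC H).
  by move=> ->; lia.
rewrite !big_split /= -addnA leq_add2l !sum_pred1.
by case: (_ <= _ < _); case: (_ <= _ < _).
Qed.
End Positions.

(** * The limit *)

Local Open Scope ring_scope.

Lemma distinct_total_cvg_large (R : realType) (N : nat) (f : nat -> nat -> nat) :
  settled N f ->
  exists M, forall n, (M <= n)%N -> (0 < n)%N ->
    cvgn (fun k => (distinct_total f (n * 2 ^ k))%:R / 4 ^+ k : R).
Proof.
move=> H.
have [inf|/existsNP[M noM]] := pselect (forall M, exists2 T, (M <= T)%N & tops f T T = 0%N).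
  have [M [C dbl]] := closed_doubling H inf.
  exists M => n Mn n0; exact: (@total_cvg_of_doubling R _ M C dbl n Mn n0).
pose M' := maxn N M.+1.
have HM : settled M' f by apply: settledW H; exact: leq_maxl.
have pos T : (M' <= T)%N -> (0 < tops f T T)%N.
  by rewrite geq_max lt0n => /andP[_ MT]; apply/eqP => z; apply: noM; exists T => //; exact: ltnW.
exists M'; apply: total_cvg => [T|]; first exact: tops_le.
by apply: weighted_cvg => //; rewrite leq_max orbT.
Qed.

(** Any [n] becomes large enough after multiplication by a power of two, which
    only shifts the sequence. *)
Lemma distinct_total_cvg (R : realType) (N : nat) (f : nat -> nat -> nat) (n : nat) :
  settled N f -> (0 < n)%N -> cvgn (fun k => (distinct_total f (n * 2 ^ k))%:R / 4 ^+ k : R).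
Proof.
move=> H n0; have [M cM] := @distinct_total_cvg_large R _ _ H.
have Mn : (M <= n * 2 ^ M)%N by apply: leq_trans (ltnW (ltn_expl M (ltnSn 1))) _; rewrite leq_pmull.
have /cvg_ex[l cl] := cM _ Mn (leq_trans n0 (leq_pmulr n (expn_gt0 2 M))).
apply/cvg_ex; exists (l / 4 ^+ M).
rewrite -(cvg_shiftn M) /=.
rewrite (_ : (fun k => _) = (fun k => (distinct_total f (n * 2 ^ M * 2 ^ k))%:R / 4 ^+ k / 4 ^+ M)).
  by apply: cvgM => //; exact: cvg_cst.
by apply/funext => k; rewrite addnC expnD mulnA exprD invfM (mulrC (4 ^+ M)^-1) mulrA.
Qed.

Theorem theorem6p1 (R : realType) (F : {fset position}) (n : nat)
    (hn : (0 < n)%N) :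
  exists l : R, l != 0 /\
    (fun k : nat => (nb_P_positions F (n * 2 ^ k))%:R
                    / (n * 2 ^ k)%:R ^+ 2 : R) @ \oo --> l.
Proof.
have [N H] := third_settled F; set f := third F in H.
have n0 : 0 < n%:R :> R by rewrite ltr0n.
have /cvg_ex[l cl] := @distinct_total_cvg R _ _ _ H hn.
have p2 k : 0 < 2 ^+ k :> R by rewrite exprn_gt0.
pose g k : R := (distinct_total f (n * 2 ^ k))%:R / 4 ^+ k / n%:R ^+ 2.
have cg : g @ \oo --> l / n%:R ^+ 2 by apply: cvgM cl _; exact: cvg_cst.
have gE k : g k = (distinct_total f (n * 2 ^ k))%:R / (n * 2 ^ k)%:R ^+ 2.
  by rewrite /g natrM natrX exprMn pow4 (mulrC (n%:R ^+ 2)) [in RHS]invfM mulrA.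
exists (l / n%:R ^+ 2); split.
  (* The box of side [2Y] contains at least [Y^2 / 12 = (2Y)^2 / 48] P-positions. *)
  apply: lt0r_neq0; apply: (@lt_le_trans _ _ (1 / 48)); first lra.
  rewrite -(cvg_lim _ cg) //; apply: limr_ge; first by apply/cvg_ex; exists (l / n%:R ^+ 2).
  near=> k.
  have k1 : (N.*2 + 6 < k)%N by near: k; exact: nbhs_infty_gt.
  have [j kE] : exists j, k = j.+1 by exists k.-1; lia.
  have Y : (N.*2 + 6 <= n * 2 ^ j)%N.
    apply: (@leq_trans (2 ^ j)); last by rewrite leq_pmull.
    by apply: leq_trans (ltnW (ltn_expl j (ltnSn 1))); lia.
  have := distinct_total_lower H Y; rewrite -muln2 -mulnA -expnSr -kE.
  rewrite -(ler_nat R) natrX !natrM natrX => lo.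
  have e : 2 ^+ k = 2 * 2 ^+ j :> R by rewrite kE exprS.
  rewrite gE natrM natrX e ler_pdivlMr; last by rewrite exprn_gt0 ?mulr_gt0.
  lra.
apply: (squeeze_cvgr _ cg (h := fun k => g k + geometric 2 2^-1 k)); last first.
  rewrite -[l / _]addr0; apply: cvgD cg _; apply: cvg_geometric.
  by rewrite ger0_norm //; lra.
near=> k; rewrite gE /=; have := nb_P_positions_bounds (n * 2 ^ k) H.
set Y := (n * 2 ^ k)%N; rewrite -!(ler_nat R) natrD natrM => /andP[lo up].
have Y0 : 0 < Y%:R :> R by rewrite ltr0n muln_gt0 hn expn_gt0.
have YV : 0 <= (Y%:R ^+ 2)^-1 :> R by rewrite invr_ge0 exprn_ge0 // ltW.
rewrite (ler_wpM2r YV lo) /=; apply: le_trans (ler_wpM2r YV up) _.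
rewrite mulrDl lerD2l expr2 invfM mulrA mulfK ?lt0r_neq0 // exprVn.
rewrite ler_pM2l // lef_pV2 ?posrE // /Y natrM natrX.
by rewrite ler_peMl ?ler1n // ltW.
Unshelve. all: by end_near. Qed.
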